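(* Let $P=(P_0,\dots,P_{2n-1})$ be a CPPOS. Then: (a) $\Phi_P$ is an involutive homeomorphism of the Möbius band of lines meeting $\operatorname{int}(P)$, and it is affine covariant: $\Phi_{F(P)}(F\ell)=F(\Phi_P(\ell))$ for every invertible affine map $F$. (b) The fixed lines of $\Phi_P$ are precisely the lines $\overline{x\,\sigma_P(x)}$, $x\in\partial P$. Their completed projective dual is exactly $\operatorname{CSS}(P)$. (c) The midpoint locus $\left\{\frac12\bigl(x+\sigma_P(x)\bigr):x\in\partial P\right\}$ is exactly $\mathrm E_{0.5}(P)$. (d) For every $p\in\operatorname{int}(P)$, $\operatorname{ART}_P(p)\subset P$. (e) If $P$ is centrally symmetric with centre $o$, then $\sigma_P(x)=2o-x$ for all $x\in\partial P$, and $\operatorname{ART}_P(p)=\{2o-p\}$ for all $p\in\operatorname{int}(P)$. (f) On a cell where the endpoints of the original chord remain on two fixed sides, the regular part of $\operatorname{ART}_P(p)$ is a conic arc or a degeneration of a conic. Hence non-smooth features of $\operatorname{ART}_P(p)$ occur only at cell transitions or at degenerate conic pieces.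
   Context: A CPPOS (convex polygon with parallel opposite sides) is a positively oriented convex polygon $P=(P_0,P_1,\dots,P_{2n-1})$, indices modulo $2n$, all $P_i$ genuine vertices (consecutive edge vectors linearly independent), whose edge vectors $e_i=P_{i+1}-P_i$ satisfy $e_{i+n}\parallel e_i$. $P$ also denotes the closed convex region bounded by it, $\operatorname{int}(P)$ its interior and $\partial P$ its boundary. Boundary involution: $\sigma_P:\partial P\to\partial P$, $\sigma_P(P_i+s e_i)=P_{i+n}+s e_{i+n}$ for $0\le s\le1$. For a line $\ell$ meeting $\operatorname{int}(P)$ with boundary intersection points $x_\ell,y_\ell$, put $\Phi_P(\ell)=\overline{\sigma_P(x_\ell)\sigma_P(y_\ell)}$. The set of lines meeting $\operatorname{int}(P)$ is an open Möbius band in the dual projective plane. Completed projective dual (completed envelope) of a continuous piecewise smooth closed curve of lines: on each smooth arc take the ordinary envelope of the lines; if $\boldsymbol\ell(t)\in\mathbb{R}^3\setminus\{0\}$ are homogeneous line coordinates, the envelope point is $[\boldsymbol\ell\times\boldsymbol\ell']$. At a corner of the curve of lines, the two one-sided envelope points lie on the same line, and the segment between them is included. For $p\in\operatorname{int}(P)$, $\Lambda_p$ is the pencil of lines through $p$ and $\operatorname{ART}_P(p)$ is the completed projective dual of $\Gamma^*_{P,p}=\Phi_P(\Lambda_p)$. A cell is a maximal open arc of $\Lambda_p$ on which the two boundary points of the line lie in two fixed open sides; a cell transition is a line of $\Lambda_p$ through a vertex of $P$. Great diagonals: $d_i=\overline{P_iP_{i+n}}$; $D_i=d_i\cap d_{i+1}$.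 $\operatorname{CSS}(P)$ is the closed polygonal chain with consecutive vertices $D_i$ (the union of the segments $D_{i-1}D_i$). With $M_i=\frac12(P_i+P_{i+n})$, the polygonal Wigner caustic $\mathrm E_{0.5}(P)$ is the closed polygonal chain with consecutive vertices $M_i$. *)

(* Defs.v *)
From HB Require Import structures.
From mathcomp Require Import all_boot all_order all_algebra.
From mathcomp Require Import all_classical all_reals all_analysis.

Set Implicit Arguments.
Unset Strict Implicit.
Unset Printing Implicit Defensive.

Import Order.TTheory GRing.Theory Num.Theory.
Import numFieldNormedType.Exports.

Local Open Scope classical_set_scope.
Local Open Scope ring_scope.

(** [P2 R] is the quotient of the nonzero vectors of R^3 by proportionality,
    with the quotient topology. It serves both for points and for lines: a line
    is the class of its homogeneous coordinates (a, b, c), a x + b y + c = 0. *)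

Section ProjectivePlane.
Variable R : realType.

Definition nzvec : Type := [set v : 'rV[R]_3 | v != 0].
HB.instance Definition _ := Topological.on nzvec.
HB.instance Definition _ := SubChoice.on nzvec.

(** [(u == v)%MS] compares row spaces. *)
Definition proportional (u v : nzvec) : bool := (\val u == \val v)%MS.

Lemma proportional_equiv : equiv_class_of proportional.
Proof.
split=> [u|u v|v u w]; rewrite /proportional.
- exact/eqmxP.
- by apply/eqmxP/eqmxP => /eqmx_sym.
- by move=> /eqmxP uv /eqmxP vw; apply/eqmxP; exact: eqmx_trans vw.
Qed.

Canonical proportional_rel := EquivRelPack proportional_equiv.

Definition P2 : Type := quotient_topology {eq_quot proportional_rel}%qT.
HB.instance Definition _ := Topological.on P2.
HB.instance Definition _ := Quotient.on P2.

Lemma const1_nz : (const_mx 1 : 'rV[R]_3) \in [set v : 'rV[R]_3 | v != 0].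
Proof.
rewrite inE /=; apply/eqP => /matrixP /(_ 0 0); rewrite !mxE.
by move/eqP; rewrite oner_eq0.
Qed.

(** The class of [v]; the value at [v = 0] is junk. *)
Definition pclass (v : 'rV[R]_3) : P2 :=
  \pi_P2%qT (insubd (Sub (const_mx 1) const1_nz : nzvec) v).

Definition hcoord (l : P2) : 'rV[R]_3 := \val (repr l).

Lemma hcoord_neq0 (l : P2) : hcoord l != 0.
Proof. by have := valP (repr l); rewrite inE. Qed.

Lemma hcoordK (l : P2) : pclass (hcoord l) = l.
Proof. by rewrite /pclass /hcoord valKd; exact: reprK. Qed.

Lemma pclassP (u v : 'rV[R]_3) : u != 0 -> v != 0 ->
  (pclass u = pclass v) <-> (u == v)%MS.
Proof.
move=> u0 v0; rewrite /pclass.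
have memE (w : 'rV[R]_3) : w != 0 -> w \in [set w : 'rV[R]_3 | w != 0].
  by move=> w0; rewrite inE.
have pE : proportional (insubd (Sub (const_mx 1) const1_nz : nzvec) u)
            (insubd (Sub (const_mx 1) const1_nz : nzvec) v) = (u == v)%MS.
  by rewrite /proportional !insubdK // memE.
by rewrite -pE; split => [/eqmodP //|h]; apply/eqmodP.
Qed.

Definition cross (u v : 'rV[R]_3) : 'rV[R]_3 :=
  \row_(k < 3) (u 0 (k + 1) * v 0 (k + 2) - u 0 (k + 2) * v 0 (k + 1)).

Definition hom (x : 'rV[R]_2) : 'rV[R]_3 := row_mx x (1 : 'rV[R]_1).

Definition pt (x : 'rV[R]_2) : P2 := pclass (hom x).

Definition on (l : P2) (x : 'rV[R]_2) : Prop := hom x *m (hcoord l)^T = 0.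

Definition join (x y : 'rV[R]_2) : P2 := pclass (cross (hom x) (hom y)).

Definition line_at_infinity : P2 := pclass (row_mx (0 : 'rV[R]_2) (1 : 'rV[R]_1)).

Definition seg (x y : 'rV[R]_2) : set 'rV[R]_2 :=
  [set (1 - s) *: x + s *: y | s in `[0, 1]].

(** The segment between two projective points: the usual one if both are
    affine; only the two end points otherwise. *)
Definition pseg (q r : P2) : set P2 := [set u | [\/ u = q, u = r |
  exists x y, [/\ q = pt x, r = pt y & (pt @` seg x y) u]]].

(** Row vectors: x |-> x A + b. *)
Definition affmap (A : 'M[R]_2) (b x : 'rV[R]_2) : 'rV[R]_2 := x *m A + b.

Definition affline (A : 'M[R]_2) (b : 'rV[R]_2) (l : P2) : P2 :=
  xget line_at_infinity [set m | on m = affmap A b @` on l].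

Definition smooth (f : R -> 'rV[R]_3) : Prop :=
  forall (k : nat) (t : R), derivable (derive1n k f) t 1.

Definition lifts (g : R -> P2) (L : R -> 'rV[R]_3) (t : R) : Prop :=
  L t != 0 /\ g t = pclass (L t).

Definition wronsk (L : R -> 'rV[R]_3) (t : R) : 'rV[R]_3 :=
  cross (L t) (derive1 L t).

(** [q] is the envelope point at [t] of the germ at [t] of [g] restricted to
    [D]; [D] is a half-line for the one-sided envelope points. It depends
    neither on the choice of the smooth lift [L] nor on the regular
    parametrization of the curve of lines. *)
Definition envelope (g : R -> P2) (D : set R) (t : R) (q : P2) : Prop :=
  exists L, [/\ smooth L, \forall s \near within D (nbhs t), lifts g L s,
                wronsk L t != 0 & q = pclass (wronsk L t)].

Definition envelope_on (g : R -> P2) (D : set R) : set P2 :=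
  [set q | exists2 t, D t & envelope g setT t q].

(** For a periodic [g], i.e. for a closed curve of lines. Where [g] is smooth
    the two one-sided envelope points agree and the segment is a point. *)
Definition completed_dual (g : R -> P2) : set P2 :=
  [set u | exists t q r, [/\ envelope g [set s | s <= t] t q,
                             envelope g [set s | t <= s] t r & pseg q r u]].

(** A closed curve of lines of period [T] cut into finitely many closed arcs,
    each with a smooth lift and a nowhere vanishing [wronsk]. *)
Definition piecewise_smooth_closed (g : R -> P2) (T : R) : Prop :=
  [/\ 0 < T, forall t, g (t + T) = g t &
    exists (k : nat) (tau : nat -> R), [/\ tau 0%N = 0, tau k = T &
      forall j, (j < k)%N -> tau j < tau j.+1 /\
        exists2 L, smooth L & forall s, tau j <= s <= tau j.+1 ->
          lifts g L s /\ wronsk L s != 0]].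

(** The curve of envelope points is a smooth immersed curve near [t]. *)
Definition dual_smooth_at (g : R -> P2) (t : R) : Prop :=
  exists m, [/\ smooth m,
    \forall s \near t, m s != 0 /\ envelope g setT s (pclass (m s)) &
    wronsk m t != 0].

Definition conic (Q : 'M[R]_3) : set P2 :=
  [set q | hcoord q *m Q *m (hcoord q)^T = 0].

Definition conic_arc (S : set P2) : Prop :=
  [/\ connected S, exists q r, [/\ S q, S r & q <> r] &
      exists Q : 'M[R]_3, [/\ Q^T = Q, Q \in unitmx & S `<=` conic Q]].

(** A connected piece (possibly a single point) of a degenerate conic: a pair
    of lines, a double line or a point. *)
Definition degenerate_conic_piece (S : set P2) : Prop :=
  [/\ connected S, S !=set0 &
      exists Q : 'M[R]_3, [/\ Q^T = Q, Q != 0, Q \notin unitmx &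
                              S `<=` conic Q]].

End ProjectivePlane.

Section Polygon.
Variables (R : realType) (n : nat).
Implicit Types (P : (n.*2).-tuple 'rV[R]_2) (p x y : 'rV[R]_2).

Definition det2 (u v : 'rV[R]_2) : R := u 0 0 * v 0 1 - u 0 1 * v 0 0.

Definition vtx P (i : nat) : 'rV[R]_2 := nth 0 P (i %% n.*2)%N.

Definition edge P (i : nat) : 'rV[R]_2 := vtx P i.+1 - vtx P i.

(** Positively oriented convex polygon: every vertex other than P_i, P_{i+1} is
    strictly to the left of the side from P_i to P_{i+1}. *)
Definition cppos P : Prop :=
  [/\ forall i j : nat, j != i %[mod n.*2] -> j != i.+1 %[mod n.*2] ->
        0 < det2 (edge P i) (vtx P j - vtx P i),
      forall i : nat, det2 (edge P i) (edge P i.+1) != 0 &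
      forall i : nat, det2 (edge P i) (edge P (i + n)) = 0].

Definition region P : set 'rV[R]_2 :=
  smallest (@convex_set R 'rV[R]_2) (range (vtx P)).

Definition bdry P : set 'rV[R]_2 :=
  [set x | exists (i : nat) (s : R), 0 <= s <= 1 /\ x = vtx P i + s *: edge P i].

Definition open_side P (i : nat) : set 'rV[R]_2 :=
  [set vtx P i + s *: edge P i | s in `]0, 1[].

Definition sigma P x : 'rV[R]_2 :=
  xget 0 [set y | exists (i : nat) (s : R), [/\ 0 <= s <= 1,
    x = vtx P i + s *: edge P i & y = vtx P (i + n) + s *: edge P (i + n)]].

Definition band P : set (P2 R) := [set l | on l `&` (region P)° !=set0].

(** Junk (the line at infinity) when [l] does not meet the boundary of [P] in
    exactly two points. *)
Definition Phi P (l : P2 R) : P2 R :=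
  xget (line_at_infinity R) [set m | exists x y,
    [/\ x <> y, on l `&` bdry P = [set x; y] & m = join (sigma P x) (sigma P y)]].

(** Orientation-reversing maps reverse the order of the vertices, so that the
    image polygon is again positively oriented. *)
Definition affpoly (A : 'M[R]_2) (b : 'rV[R]_2) P : (n.*2).-tuple 'rV[R]_2 :=
  if 0 < \det A then [tuple of map (affmap A b) P]
  else [tuple of rev (map (affmap A b) P)].

(** The boundary point P_i + (t - i) e_i for i <= t < i + 1, extended
    2n-periodically. *)
Definition bdry_param P (t : R) : 'rV[R]_2 :=
  let i := `|(Num.floor t %% (n.*2)%:Z)%Z|%N in
  vtx P i + (t - (Num.floor t)%:~R) *: edge P i.

Definition fixed_curve P (t : R) : P2 R :=
  join (bdry_param P t) (sigma P (bdry_param P t)).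

Definition diagonal P (i : nat) : P2 R := join (vtx P i) (vtx P (i + n)).

Definition Dpt P (i : nat) : 'rV[R]_2 :=
  xget 0 (on (diagonal P i) `&` on (diagonal P i.+1)).

Definition CSS P : set 'rV[R]_2 :=
  [set x | exists i : nat, seg (Dpt P i) (Dpt P i.+1) x].

Definition midpt P (i : nat) : 'rV[R]_2 := 2^-1 *: (vtx P i + vtx P (i + n)).

Definition wigner P : set 'rV[R]_2 :=
  [set x | exists i : nat, seg (midpt P i) (midpt P i.+1) x].

(** The line through [p] of direction (cos t, sin t): a parametrization, of
    period pi, of the pencil of lines through [p]. *)
Definition pencil p (t : R) : P2 R :=
  join p (p + \row_(k < 2) (if k == 0 then cos t else sin t)).

Definition Gamma P p (t : R) : P2 R := Phi P (pencil p t).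

Definition ART P p : set (P2 R) := completed_dual (Gamma P p).

Definition ends_on P p (i j : nat) (t : R) : Prop :=
  exists x y, [/\ open_side P i x, open_side P j y &
                  on (pencil p t) `&` bdry P = [set x; y]].

(** Cells and their open arcs, as intervals of the parameter of [pencil]. *)
Definition cell P p (i j : nat) (a b : R) : Prop :=
  [/\ a < b, forall t, a < t < b -> ends_on P p i j t &
      forall a' b', a' <= a -> b <= b' ->
        (forall t, a' < t < b' -> ends_on P p i j t) -> a' = a /\ b' = b].

Definition transition P p (t : R) : Prop :=
  exists i : nat, on (pencil p t) (vtx P i).

End Polygon.

(* Main.v *)
Require Import Defs.
From HB Require Import structures.
From mathcomp Require Import all_boot all_order all_algebra.
From mathcomp Require Import all_classical all_reals all_analysis.
From mathcomp Require Import ring lra zify.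

Set Implicit Arguments.
Unset Strict Implicit.
Unset Printing Implicit Defensive.

Import Order.TTheory GRing.Theory Num.Theory.
Import numFieldNormedType.Exports.
Local Open Scope classical_set_scope.
Local Open Scope ring_scope.

(** A line meeting the interior of [P] is determined by its two boundary points
    [x] and [y], which lie on no common side; conversely two boundary points on
    no common side span such a line ([band_chord]). Since every boundary point
    lies in the closed half-planes of all sides, a ray from an interior point
    meets the boundary only once ([ray_bdry_eq]), so [Phi] sends the chord from
    [x] to [y] to the chord from [sigma x] to [sigma y] ([Phi_join]). Involution
    and affine covariance follow from those of [sigma]. For continuity, let [v]
    be coordinates of a line that leaves [P] through the side [i] and enters it
    through the side [j]. The image of each crossing point is then linear in
    [v] up to a factor ([exit_image]), so [Phi] is given by one of finitely many
    polynomial formulas ([Phi_exits]), and these agree where several apply.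

    The side [i] and the opposite one are antiparallel, and [sigma] is the
    homothety of negative ratio between them. Its centre is the intersection of
    two consecutive great diagonals. Hence the lines through [x] and [sigma x]
    turn about this centre while [x] runs over the side ([fixed_join],
    [wronsk_fixed]): the envelope is one point per side, and at a vertex the
    completed dual joins the points of the two adjacent sides ([dual_fixed]).

    For the pencil at [p], the two polynomial formulas for the end points are
    linear in the cosine and the sine of the angle, so the image line has a lift
    that is quadratic in them ([glift_quad]), and so is its Wronskian
    ([wronsk_quad]). The Wronskian is a combination of the two end points of the
    image chord whose coefficients have an explicit sign ([wronsk_glift]): they
    are positive, because each end point advances along its side, and the other
    one lies strictly inside the half-plane of that side. So the envelope point
    divides the chord internally ([wronsk_exits]), which proves that the dual is
    contained in [P] and that the curve of lines is piecewise regular.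

    In a cell the envelope is a quadratically parametrized curve. If its three
    coefficients are independent, it is the projective image of an arc of
    [y^2 = x z], hence regular and on a nondegenerate conic; otherwise it lies
    on a line ([quad_curve_conic], [quad_curve_regular], [quad_curve_line]).

    If [P] is symmetric about [o], then [sigma] is the reflection in [o]
    ([central_sigma]), so [Phi] maps the pencil at [p] onto the pencil at
    [2 o - p], whose envelope is that point ([central_ART]).

    Envelope points are defined through an arbitrary lift; [envelope_eq] shows
    that any convenient one computes them, also on one side only. *)

Local Notation hom := Defs.hom.

(** * Homogeneous coordinates *)
Section Coordinates.
Variable R : realType.
Implicit Types (x y z p u : 'rV[R]_2) (v w : 'rV[R]_3) (l m : P2 R).

Lemma row2P x y : x 0 0 = y 0 0 -> x 0 1 = y 0 1 -> x = y.
Proof.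
move=> h0 h1; apply/rowP => -[[|[|k]] hk] //.
- by rewrite (_ : Ordinal hk = 0) //; apply: val_inj.
- by rewrite (_ : Ordinal hk = 1) //; apply: val_inj.
Qed.

Lemma row3P v w :
  v 0 0 = w 0 0 -> v 0 1 = w 0 1 -> v 0 2 = w 0 2 -> v = w.
Proof.
move=> h0 h1 h2; apply/rowP => -[[|[|[|k]]] hk] //.
- by rewrite (_ : Ordinal hk = 0) //; apply: val_inj.
- by rewrite (_ : Ordinal hk = 1) //; apply: val_inj.
- by rewrite (_ : Ordinal hk = 2) //; apply: val_inj.
Qed.

Lemma cross0 v w : cross v w 0 0 = v 0 1 * w 0 2 - v 0 2 * w 0 1.
Proof. by rewrite /cross mxE !add0r. Qed.

Lemma cross1 v w : cross v w 0 1 = v 0 2 * w 0 0 - v 0 0 * w 0 2.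
Proof.
rewrite /cross mxE (_ : 1 + 1 = 2 :> 'I_3); last exact: val_inj.
by rewrite (_ : 1 + 2 = 0 :> 'I_3) //; apply: val_inj.
Qed.

Lemma cross2 v w : cross v w 0 2 = v 0 0 * w 0 1 - v 0 1 * w 0 0.
Proof.
rewrite /cross mxE (_ : 2 + 1 = 0 :> 'I_3); last exact: val_inj.
by rewrite (_ : 2 + 2 = 1 :> 'I_3) //; apply: val_inj.
Qed.

Definition crossE := (cross0, cross1, cross2).

(** The vector with homogeneous coordinates [(x, c)]: the point [x] when
    [c = 1], a direction when [c = 0]. *)
Definition ext (x : 'rV[R]_2) (c : R) : 'rV[R]_3 := row_mx x (c%:M : 'M[R]_1).

Lemma ext0 x c : ext x c 0 0 = x 0 0.
Proof.
rewrite /ext mxE; case: splitP => [j|j] hj; last by case: j hj.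
by congr (x _ _); apply: val_inj.
Qed.

Lemma ext1 x c : ext x c 0 1 = x 0 1.
Proof.
rewrite /ext mxE; case: splitP => [j|j] hj; last by case: j hj.
by congr (x _ _); apply: val_inj.
Qed.

Lemma ext2 x c : ext x c 0 2 = c.
Proof.
rewrite /ext mxE; case: splitP => [j hj|j hj].
  by have := ltn_ord j; rewrite -hj.
by rewrite mxE (ord1 j) eqxx.
Qed.

Lemma addmxE_ij k h (A B : 'M[R]_(k, h)) i j : (A + B) i j = A i j + B i j.
Proof. by rewrite mxE. Qed.

Lemma oppmxE_ij k h (A : 'M[R]_(k, h)) i j : (- A) i j = - A i j.
Proof. by rewrite mxE. Qed.

Lemma scalemxE_ij k h a (A : 'M[R]_(k, h)) i j : (a *: A) i j = a * A i j.
Proof. by rewrite mxE. Qed.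

(** [mxE] would also unfold [hom], [ext] and [cross]; these rules stop at the
    terms of a linear combination. *)
Definition entryE := (addmxE_ij, oppmxE_ij, scalemxE_ij).

Lemma homE x : hom x = ext x 1.
Proof. by []. Qed.

Definition extE := (ext0, ext1, ext2).

Definition dot v w : R := v 0 0 * w 0 0 + v 0 1 * w 0 1 + v 0 2 * w 0 2.

Definition ev v x : R := dot v (hom x).

Lemma evE v x : ev v x = v 0 0 * x 0 0 + v 0 1 * x 0 1 + v 0 2.
Proof. by rewrite /ev /dot homE !extE mulr1. Qed.

Lemma dotE v w : v *m w^T = (dot v w)%:M.
Proof.
apply/rowP => i; rewrite (ord1 i) !mxE eqxx /= mulr1n /dot.
rewrite !big_ord_recl big_ord0 addr0 !mxE addrA.
rewrite (_ : lift ord0 ord0 = 1 :> 'I_3); last exact: val_inj.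
by rewrite (_ : lift ord0 (lift ord0 ord0) = 2 :> 'I_3) //; apply: val_inj.
Qed.

Lemma det2E x y : det2 x y = x 0 0 * y 0 1 - x 0 1 * y 0 0.
Proof. by []. Qed.

Lemma row3_neq0 v : (v != 0) = [|| v 0 0 != 0, v 0 1 != 0 | v 0 2 != 0].
Proof.
apply/idP/idP => [v0|]; last first.
  by apply: contraTneq => ->; rewrite !mxE eqxx.
apply: contraNT v0; rewrite !negb_or !negbK => /and3P[/eqP h0 /eqP h1 /eqP h2].
by apply/eqP/row3P; rewrite ?h0 ?h1 ?h2 mxE.
Qed.

Lemma row2_neq0 x : (x != 0) = (x 0 0 != 0) || (x 0 1 != 0).
Proof.
apply/idP/idP => [x0|]; last first.
  by apply: contraTneq => ->; rewrite !mxE eqxx.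
apply: contraNT x0; rewrite !negb_or !negbK => /andP[/eqP h0 /eqP h1].
by apply/eqP/row2P; rewrite ?h0 ?h1 mxE.
Qed.

Lemma hom_neq0 x : hom x != 0.
Proof. by rewrite row3_neq0 homE !extE oner_eq0 !orbT. Qed.

Lemma crossvv v : cross v v = 0.
Proof. by apply: row3P; rewrite crossE mxE; ring. Qed.

Lemma cross0v v : cross 0 v = 0.
Proof. by apply: row3P; rewrite crossE !mxE; ring. Qed.

Lemma crossC v w : cross v w = - cross w v.
Proof. by apply: row3P; rewrite [RHS]mxE !crossE; ring. Qed.

Lemma crossZl a v w : cross (a *: v) w = a *: cross v w.
Proof. by apply: row3P; rewrite [RHS]mxE !crossE !mxE; ring. Qed.

Lemma crossZr a v w : cross v (a *: w) = a *: cross v w.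
Proof. by apply: row3P; rewrite [RHS]mxE !crossE !mxE; ring. Qed.

Lemma cross_eq0 v w : v != 0 -> w != 0 -> cross v w = 0 ->
  exists2 c : R, c != 0 & v = c *: w.
Proof.
move=> v0 w0 h.
have h0 : v 0 1 * w 0 2 - v 0 2 * w 0 1 = 0 by rewrite -cross0 h mxE.
have h1 : v 0 2 * w 0 0 - v 0 0 * w 0 2 = 0 by rewrite -cross1 h mxE.
have h2 : v 0 0 * w 0 1 - v 0 1 * w 0 0 = 0 by rewrite -cross2 h mxE.
suff [c vE] : exists c : R, v = c *: w.
  by exists c => //; apply: contraNneq v0 => c0; rewrite vE c0 scale0r.
move: w0; rewrite row3_neq0 => /or3P[] w0.
- exists (v 0 0 / w 0 0); apply: row3P; rewrite mxE ?divfK //.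
  + by apply: (mulIf w0); rewrite mulrAC divfK //; lra.
  + by apply: (mulIf w0); rewrite mulrAC divfK //; lra.
- exists (v 0 1 / w 0 1); apply: row3P; rewrite mxE ?divfK //.
  + by apply: (mulIf w0); rewrite mulrAC divfK //; lra.
  + by apply: (mulIf w0); rewrite mulrAC divfK //; lra.
- exists (v 0 2 / w 0 2); apply: row3P; rewrite mxE ?divfK //.
  + by apply: (mulIf w0); rewrite mulrAC divfK //; lra.
  + by apply: (mulIf w0); rewrite mulrAC divfK //; lra.
Qed.

Lemma pclassZ c v : c != 0 -> v != 0 -> pclass (c *: v) = pclass v.
Proof.
move=> c0 v0; apply/pclassP => //; first by rewrite scaler_eq0 negb_or c0.
by apply/eqmxP/eqmx_scale.
Qed.

Lemma pclass_prop v w : v != 0 -> w != 0 -> pclass v = pclass w ->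
  exists2 c : R, c != 0 & v = c *: w.
Proof.
move=> v0 w0 /(pclassP v0 w0)/andP[/sub_rVP[c vE] _]; exists c => //.
by apply: contraNneq v0 => c0; rewrite vE c0 scale0r.
Qed.

Lemma hcoord_pclass v : v != 0 ->
  exists2 c : R, c != 0 & hcoord (pclass v) = c *: v.
Proof.
by move=> v0; apply: pclass_prop => //; [exact: hcoord_neq0|exact: hcoordK].
Qed.

Lemma onE l x : on l x <-> ev (hcoord l) x = 0.
Proof.
rewrite /on -[hom x *m _]trmxK trmx_mul trmxK dotE -/(ev _ _) tr_scalar_mx.
by split=> [/rowP/(_ 0)|->]; rewrite ?scalemx1 ?raddf0 // !mxE eqxx mulr1n.
Qed.

Lemma on_pclass v x : v != 0 -> on (pclass v) x <-> ev v x = 0.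
Proof.
move=> v0; rewrite onE; have [c c0 ->] := hcoord_pclass v0.
rewrite !evE !mxE -!mulrA -!mulrDr; split => [/eqP|->]; last by rewrite mulr0.
by rewrite mulf_eq0 (negPf c0) => /eqP.
Qed.

Lemma pt_inj : injective (@pt R).
Proof.
move=> x y /(pclass_prop (hom_neq0 x) (hom_neq0 y))[c c0 /rowP h].
have := h 2; rewrite [RHS]mxE !homE !extE mulr1 => c1.
apply: row2P; [have := h 0 | have := h 1];
  by rewrite [RHS]mxE !homE !extE -c1 mul1r.
Qed.

(** Homogeneous coordinates of the line through [p] of direction [u], scaled so
    that evaluation at a point is a plane determinant. *)
Definition lin p u : 'rV[R]_3 := cross (hom p) (ext u 0).

Lemma linE p u : (lin p u 0 0 = - u 0 1) * (lin p u 0 1 = u 0 0) *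
  (lin p u 0 2 = p 0 0 * u 0 1 - p 0 1 * u 0 0).
Proof. by split; first split; rewrite /lin crossE homE !extE; ring. Qed.

Lemma ev_lin p u z : ev (lin p u) z = det2 u (z - p).
Proof. by rewrite evE !linE det2E !mxE; ring. Qed.

Lemma lin_neq0 p u : u != 0 -> lin p u != 0.
Proof.
rewrite row3_neq0 row2_neq0 !linE oppr_eq0 => /orP[] ->; by rewrite ?orbT.
Qed.

Lemma cross_hom p q : cross (hom p) (hom q) = lin p (q - p).
Proof.
by apply: row3P; rewrite !linE crossE !homE !extE !mxE; ring.
Qed.

Lemma on_lin p u z : u != 0 -> on (pclass (lin p u)) z <-> det2 u (z - p) = 0.
Proof. by move=> u0; rewrite on_pclass ?lin_neq0 // ev_lin. Qed.

Lemma joinE x y : join x y = pclass (lin x (y - x)).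
Proof. by rewrite /join cross_hom. Qed.

Lemma on_join x y z : x <> y -> on (join x y) z <-> det2 (y - x) (z - x) = 0.
Proof.
by move=> xy; rewrite joinE on_lin // subr_eq0; apply/eqP => /esym.
Qed.

Lemma join_sym x y : join x y = join y x.
Proof.
have [->//|/eqP xy] := pselect (x = y).
rewrite /join crossC -scaleN1r pclassZ // ?oppr_eq0 ?oner_eq0 //.
by rewrite cross_hom lin_neq0 // subr_eq0.
Qed.

Lemma det2vv x : det2 x x = 0.
Proof. by rewrite det2E; ring. Qed.

Lemma det2_prop u z : u != 0 -> det2 u z = 0 -> exists a : R, z = a *: u.
Proof.
rewrite det2E row2_neq0 => u0 h; case/orP: u0 => u0.
  exists (z 0 0 / u 0 0); apply: row2P; rewrite mxE ?divfK //.
  by apply: (mulIf u0); rewrite mulrAC divfK //; lra.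
exists (z 0 1 / u 0 1); apply: row2P; rewrite mxE ?divfK //.
by apply: (mulIf u0); rewrite mulrAC divfK //; lra.
Qed.

(** Turns arbitrary coordinates of a line with an affine point into the
    parametrized form in which sides and rays are compared. *)
Lemma ev_direction v p : v != 0 -> ev v p = 0 ->
  exists2 u, u != 0 & v = lin p u.
Proof.
move=> v0; rewrite evE => h.
exists (\row_k if k == 0 then v 0 1 else - v 0 0); last first.
  by apply: row3P; rewrite linE !mxE /=; lra.
move: v0; rewrite row3_neq0 row2_neq0 !mxE /= oppr_eq0.
apply: contraLR; rewrite !negb_or !negbK => /andP[/eqP h0 /eqP h1].
by rewrite h1 h0 eqxx /=; apply/eqP; move: h; rewrite h1 h0; lra.
Qed.

Lemma join_on l x y : x <> y -> on l x -> on l y -> l = join x y.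
Proof.
move=> /eqP xy /onE hx /onE hy; rewrite -(hcoordK l) joinE.
have [u u0 hl] := ev_direction (hcoord_neq0 l) hx.
have yx0 : y - x != 0 by rewrite subr_eq0 eq_sym.
have hyx : det2 u (y - x) = 0 by rewrite -ev_lin -hl.
have [a ya] := det2_prop u0 hyx.
have a0 : a != 0 by apply: contraNneq yx0 => a0; rewrite ya a0 scale0r.
rewrite hl ya (_ : lin x (a *: u) = a *: lin x u) ?pclassZ ?lin_neq0 //.
by apply: row3P; rewrite [RHS]mxE !linE !mxE; ring.
Qed.

End Coordinates.

(** * Polygons with parallel opposite sides *)
Section Det2.
Variable R : realType.
Implicit Types x y z u : 'rV[R]_2.

Lemma det2C x y : det2 x y = - det2 y x.
Proof. by rewrite !det2E; ring. Qed.

Lemma det2Br x y z : det2 x (y - z) = det2 x y - det2 x z.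
Proof. by rewrite !det2E !mxE; ring. Qed.

Lemma det2Zr a x y : det2 x (a *: y) = a * det2 x y.
Proof. by rewrite !det2E !mxE; ring. Qed.

Lemma det2Zl a x y : det2 (a *: x) y = a * det2 x y.
Proof. by rewrite !det2E !mxE; ring. Qed.

Lemma det2r0 x : det2 x 0 = 0.
Proof. by rewrite !det2E !mxE; ring. Qed.

Lemma det20r x : det2 0 x = 0.
Proof. by rewrite !det2E !mxE; ring. Qed.

Lemma det2Nr x y : det2 x (- y) = - det2 x y.
Proof. by rewrite !det2E !mxE; ring. Qed.

(** The Pluecker relation in the plane. *)
Lemma det2_plucker x y z u :
  det2 x y * det2 z u - det2 x z * det2 y u + det2 x u * det2 y z = 0.
Proof. by rewrite !det2E; ring. Qed.

Lemma det2_basis u x y : det2 u x = 0 -> det2 u y = 0 -> det2 y x != 0 -> u = 0.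
Proof.
move=> hx hy D0.
have h0 : u 0 0 * det2 y x = y 0 0 * det2 u x - x 0 0 * det2 u y.
  by rewrite !det2E; ring.
have h1 : u 0 1 * det2 y x = y 0 1 * det2 u x - x 0 1 * det2 u y.
  by rewrite !det2E; ring.
move: h0 h1; rewrite hx hy !mulr0 subrr => /eqP h0 /eqP h1.
move: h0 h1; rewrite !mulf_eq0 (negPf D0) !orbF => /eqP h0 /eqP h1.
by apply: row2P; rewrite mxE.
Qed.

End Det2.

Section ConvexPolygon.
Variables (R : realType) (n : nat).
Variable P : (n.*2).-tuple 'rV[R]_2.
Hypothesis hP : cppos P.
Implicit Types (i j k : nat) (p x y z u : 'rV[R]_2) (v w : 'rV[R]_3).

Lemma vtx_mod i j : i = j %[mod n.*2] -> vtx P i = vtx P j.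
Proof. by rewrite /vtx => ->. Qed.

Lemma modnS_eq i j : i = j %[mod n.*2] -> i.+1 = j.+1 %[mod n.*2].
Proof. by move=> h; rewrite -addn1 -[j.+1]addn1 -modnDml h modnDml. Qed.

Lemma modnD_eq k i j : i = j %[mod n.*2] -> (i + k = j + k %[mod n.*2])%N.
Proof. by move=> h; rewrite -modnDml h modnDml. Qed.

Lemma edge_mod i j : i = j %[mod n.*2] -> edge P i = edge P j.
Proof. by move=> h; rewrite /edge (vtx_mod h) (vtx_mod (modnS_eq h)). Qed.

Lemma vtxS i : vtx P i.+1 = vtx P i + edge P i.
Proof. by rewrite /edge addrC subrK. Qed.

Lemma half_gt1 : (1 < n)%N.
Proof.
case: hP => h1 h2 _; case: n P h1 h2 => [|[|//]] Q h1 h2.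
  have := h2 0%N; rewrite /edge /vtx nth_default ?size_tuple //.
  by rewrite nth_default ?size_tuple // subrr det20r eqxx.
have := h2 0%N; rewrite (_ : edge Q 1 = (-1) *: edge Q 0).
  by rewrite det2Zr det2vv mulr0 eqxx.
by rewrite /edge /vtx scaleN1r opprB.
Qed.

(** Positive on the left of the side from P_i to P_(i+1), zero on its line. *)
Definition side i x : R := det2 (edge P i) (x - vtx P i).

Lemma sideE i x : side i x = det2 (edge P i) (x - vtx P i).
Proof. by []. Qed.

Definition inner p := forall i, 0 < side i p.

Definition epoint i (s : R) : 'rV[R]_2 := vtx P i + s *: edge P i.

Lemma epointDE i s : epoint i s = vtx P i + s *: edge P i.
Proof. by []. Qed.

Lemma epoint0 i : epoint i 0 = vtx P i.
Proof. by rewrite /epoint scale0r addr0. Qed.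

Lemma epoint1 i : epoint i 1 = vtx P i.+1.
Proof. by rewrite /epoint scale1r vtxS. Qed.

Lemma epoint_mod i j s : i = j %[mod n.*2] -> epoint i s = epoint j s.
Proof. by move=> h; rewrite /epoint (vtx_mod h) (edge_mod h). Qed.

Lemma epointE i s : epoint i s = (1 - s) *: vtx P i + s *: vtx P i.+1.
Proof. by rewrite vtxS; apply: row2P; rewrite !mxE; ring. Qed.

Lemma side_mod i j x : i = j %[mod n.*2] -> side i x = side j x.
Proof. by move=> h; rewrite /side (vtx_mod h) (edge_mod h). Qed.

Lemma side_comb i s x y :
  side i ((1 - s) *: x + s *: y) = (1 - s) * side i x + s * side i y.
Proof. by rewrite /side !det2E !mxE; ring. Qed.

Lemma side_ray i p c u :
  side i (p + c *: u) = side i p + c * det2 (edge P i) u.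
Proof. by rewrite /side !det2E !mxE; ring. Qed.

Lemma side_epoint_self i s : side i (epoint i s) = 0.
Proof. by rewrite /side /epoint addrC addKr det2Zr det2vv mulr0. Qed.

Lemma side_vtx_gt0 i j : j <> i %[mod n.*2] -> j <> i.+1 %[mod n.*2] ->
  0 < side i (vtx P j).
Proof. by move=> /eqP h1 /eqP h2; case: hP => h _ _; exact: h. Qed.

Lemma side_vtx_eq0 i j : side i (vtx P j) = 0 ->
  j = i %[mod n.*2] \/ j = i.+1 %[mod n.*2].
Proof.
move=> h; have [|h1] := pselect (j = i %[mod n.*2]); first by left.
have [|h2] := pselect (j = i.+1 %[mod n.*2]); first by right.
by have := side_vtx_gt0 h1 h2; rewrite h ltxx.
Qed.

Lemma side_vtx_ge0 i j : 0 <= side i (vtx P j).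
Proof.
have [h1|h1] := pselect (j = i %[mod n.*2]).
  by rewrite (vtx_mod h1) -epoint0 side_epoint_self.
have [h2|h2] := pselect (j = i.+1 %[mod n.*2]).
  by rewrite (vtx_mod h2) -epoint1 side_epoint_self.
exact/ltW/side_vtx_gt0.
Qed.

Lemma neq_mod_small i a b : (a < b)%N -> (b < n.*2)%N ->
  (i + b)%N <> (i + a)%N %[mod n.*2].
Proof.
move=> ab bn /eqP; rewrite eqn_modDl !modn_small //; last exact: ltn_trans ab bn.
by rewrite gtn_eqF.
Qed.

Lemma side_opp_gt0 i : 0 < side i (vtx P (i + n)).
Proof.
have n1 := half_gt1.
apply: side_vtx_gt0; first by rewrite -[in RHS](addn0 i); apply: neq_mod_small; lia.
by rewrite -[in RHS](addn1 i); apply: neq_mod_small; lia.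
Qed.

Lemma det2_edgeS i : 0 < det2 (edge P i) (edge P i.+1).
Proof.
have n1 := half_gt1.
have : 0 < side i (vtx P i.+2).
  apply: side_vtx_gt0.
    by rewrite -[in RHS](addn0 i) -addn2; apply: neq_mod_small; lia.
  by rewrite -[in RHS](addn1 i) -addn2; apply: neq_mod_small; lia.
by rewrite /side !vtxS !det2E !mxE; lra.
Qed.

Lemma edge_neq0 i : edge P i != 0.
Proof.
by apply/eqP => h; have := det2_edgeS i; rewrite h det20r ltxx.
Qed.

Lemma vtxDD i : vtx P (i + n + n) = vtx P i.
Proof. by apply: vtx_mod; rewrite -addnA addnn modnDr. Qed.

Lemma edgeDD i : edge P (i + n + n) = edge P i.
Proof. by apply: edge_mod; rewrite -addnA addnn modnDr. Qed.

Lemma epointDD i s : epoint (i + n + n) s = epoint i s.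
Proof. by apply: epoint_mod; rewrite -addnA addnn modnDr. Qed.

(** Each of two opposite sides lies strictly to the left of the other, which
    fixes the sign of the factor between their edge vectors. *)
Lemma edge_opp i : exists2 r : R, 0 < r & edge P (i + n) = (- r) *: edge P i.
Proof.
case: hP => _ _ /(_ i) h.
have [a aE] := det2_prop (edge_neq0 i) h.
exists (- a); last by rewrite opprK.
have h1 := side_opp_gt0 i.
have := side_opp_gt0 (i + n)%N; rewrite /side vtxDD aE det2Zl.
rewrite -(opprB (vtx P (i + n))) det2Nr mulrN -mulNr.
by rewrite pmulr_lgt0.
Qed.

Lemma side_epoint_opp i s : side i (epoint (i + n) s) = side i (vtx P (i + n)).
Proof.
by have [r _ h] := edge_opp i;
  rewrite {1}/epoint side_ray h det2Zr det2vv !mulr0 addr0.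
Qed.

Lemma epoint_inj i : injective (epoint i).
Proof.
move=> s t /addrI /eqP; rewrite -subr_eq0 -scalerBl scaler_eq0.
by rewrite (negPf (edge_neq0 i)) orbF subr_eq0 => /eqP.
Qed.

Lemma vtx_on_epoint i j t : vtx P i = epoint j t ->
  (i = j %[mod n.*2] /\ t = 0) \/ (i = j.+1 %[mod n.*2] /\ t = 1).
Proof.
move=> h; have := side_epoint_self j t; rewrite -h.
move=> /side_vtx_eq0[] e; [left|right]; split => //; apply: (@epoint_inj j).
  by rewrite -h epoint0; exact: vtx_mod.
by rewrite -h epoint1; exact: vtx_mod.
Qed.

Lemma epoint_opp_eq i j s t : 0 <= s <= 1 -> 0 <= t <= 1 ->
  epoint i s = epoint j t -> epoint (i + n) s = epoint (j + n) t.
Proof.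
have n1 := half_gt1.
move=> /andP[s0 s1] t01; move: s0; rewrite le_eqVlt => /orP[/eqP <-|s0].
  rewrite !epoint0 => /vtx_on_epoint[[e ->]|[e ->]].
    by rewrite epoint0; apply/vtx_mod/modnD_eq.
  by rewrite epoint1 -addSn; apply/vtx_mod/modnD_eq.
move: s1; rewrite le_eqVlt => /orP[/eqP ->|s1].
  rewrite !epoint1 => /vtx_on_epoint[[e ->]|[e ->]].
    by rewrite epoint0 -addSn; apply/vtx_mod/modnD_eq.
  by rewrite epoint1 -!addSn; apply/vtx_mod/modnD_eq.
move=> h; suff e : i = j %[mod n.*2].
  rewrite (epoint_mod _ (modnD_eq n e)); congr epoint.
  by apply: (@epoint_inj j); rewrite -h; apply: epoint_mod.
have := side_epoint_self j t; rewrite -h epointE side_comb.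
have h1 := side_vtx_ge0 j i; have h2 := side_vtx_ge0 j i.+1.
have s1' : 0 < 1 - s by rewrite subr_gt0.
have := mulr_ge0 (ltW s1') h1; have := mulr_ge0 (ltW s0) h2 => h3 h4 h5.
have /eqP : (1 - s) * side j (vtx P i) = 0 by lra.
rewrite mulf_eq0 gt_eqF //= => /eqP /side_vtx_eq0[//|e1].
have /eqP : s * side j (vtx P i.+1) = 0 by lra.
rewrite mulf_eq0 gt_eqF //= => /eqP /side_vtx_eq0[e2|].
  exfalso; have := modnS_eq e1; rewrite e2.
  by rewrite -[in LHS](addn0 j) -addn2; apply/nesym/neq_mod_small; clear -n1; lia.
move=> /eqP; rewrite -addn1 -(addn1 j) eqn_modDr => /eqP e2.
exact: e2.
Qed.

Lemma bdry_epoint i s : 0 <= s <= 1 -> bdry P (epoint i s).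
Proof. by move=> s01; exists i, s. Qed.

Lemma sigma_epoint i s : 0 <= s <= 1 ->
  sigma P (epoint i s) = epoint (i + n) s.
Proof.
move=> s01; apply: xget_unique; first by exists i, s.
move=> y [j [t [t01 h ->]]]; apply/esym.
exact: epoint_opp_eq.
Qed.

Lemma bdry_sigma x : bdry P x -> bdry P (sigma P x).
Proof.
by move=> [i [s [s01 ->]]]; rewrite sigma_epoint //; exact: bdry_epoint.
Qed.

Lemma sigmaK x : bdry P x -> sigma P (sigma P x) = x.
Proof.
by move=> [i [s [s01 ->]]]; rewrite !sigma_epoint // epointDD.
Qed.

Lemma side_epoint_ge0 k i s : 0 <= s <= 1 -> 0 <= side k (epoint i s).
Proof.
move=> /andP[s0 s1]; rewrite epointE side_comb.
by rewrite addr_ge0 // mulr_ge0 ?side_vtx_ge0 // subr_ge0.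
Qed.

Lemma side_bdry_ge0 k x : bdry P x -> 0 <= side k x.
Proof. by move=> [i [s [s01 ->]]]; exact: side_epoint_ge0. Qed.

(** The half-planes of the two adjacent sides cut off the rest of the line. *)
Lemma side_eq0 i x : (forall k, 0 <= side k x) -> side i x = 0 ->
  exists2 s, 0 <= s <= 1 & x = epoint i s.
Proof.
have n1 := half_gt1.
move=> hx /(det2_prop (edge_neq0 i))[a ha].
have xE : x = epoint i a by rewrite /epoint -ha addrC subrK.
exists a => //; apply/andP; split.
  (* This is the predecessor of [i] modulo [2 n]; [i.-1] is wrong for [i = 0]. *)
  have := hx (i + n.*2.-1)%N; rewrite xE {1}/epoint side_ray.
  have e : ((i + n.*2.-1).+1 = i %[mod n.*2])%N.
    by rewrite -addnS prednK ?modnDr //; lia.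
  rewrite -(vtx_mod e) -epoint1 side_epoint_self add0r.
  rewrite -(edge_mod e) pmulr_lge0 //; exact: det2_edgeS.
have := hx i.+1; rewrite xE (_ : epoint i a = vtx P i.+1 + (a - 1) *: edge P i).
  rewrite side_ray -epoint0 side_epoint_self add0r det2C mulrN -mulNr opprB.
  by rewrite pmulr_lge0 ?det2_edgeS // subr_ge0.
by rewrite vtxS /epoint; apply: row2P; rewrite !mxE; ring.
Qed.

Lemma sigma_side i x : bdry P x -> side i x = 0 -> side (i + n) (sigma P x) = 0.
Proof.
move=> bx h; have [s s01 ->] := side_eq0 (fun k => side_bdry_ge0 k bx) h.
by rewrite sigma_epoint // side_epoint_self.
Qed.

Lemma side_sigma_gt0 i x : bdry P x -> side i x = 0 -> 0 < side i (sigma P x).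
Proof.
move=> bx h; have [s s01 ->] := side_eq0 (fun k => side_bdry_ge0 k bx) h.
by rewrite sigma_epoint // side_epoint_opp side_opp_gt0.
Qed.

Lemma bdry_side x : bdry P x -> exists i, side i x = 0.
Proof. by move=> [i [s [_ ->]]]; exists i; exact: side_epoint_self. Qed.

(** At a vertex minimizing a linear form the two adjacent edges both point
    upwards, which puts the interior strictly above it. *)
Lemma inner_sign p u : inner p -> u != 0 ->
  exists i, det2 u (vtx P i - p) < 0.
Proof.
move=> hp u0; have n1 := half_gt1.
pose f i := det2 u (vtx P i - p).
have N0 : (0 < n.*2)%N by lia.
have [k _ hk] : exists2 k : 'I_(n.*2), True & forall j, f k <= f j.
  have [k _ kmin] := @arg_minP _ _ _ (Ordinal N0) xpredT (fun i : 'I_(n.*2) => f i) erefl.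
  exists k => // j; have := kmin (Ordinal (ltn_pmod j N0)) erefl.
  by rewrite /f /= (@vtx_mod (j %% n.*2) j) // modn_mod.
exists k; rewrite ltNge; apply/negP => fk; move/eqP: u0; apply.
pose k' := (k + n.*2.-1)%N.
have e : k'.+1 = k %[mod n.*2] by rewrite -addnS prednK ?modnDr //; lia.
have vk : vtx P k'.+1 = vtx P k := vtx_mod e.
have h1 := hk k.+1; have h2 := hk k'.
have D0 : 0 < det2 (edge P k') (edge P k) by rewrite -(edge_mod e) det2_edgeS.
have S1 := hp k; have S2 := hp k'.
have a0 : 0 <= det2 u (edge P k).
  by move: h1; rewrite /f vtxS !det2E !mxE; lra.
have b0 : det2 u (edge P k') <= 0.
  by move: h2; rewrite /f -vk vtxS !det2E !mxE; lra.
have T1 : 0 < det2 (vtx P k - p) (edge P k).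
  by move: S1; rewrite /side !det2E !mxE; lra.
have T2 : 0 < det2 (vtx P k - p) (edge P k').
  move: S2; rewrite /side (_ : vtx P k' = vtx P k - edge P k').
    by rewrite !det2E !mxE; lra.
  by rewrite -vk vtxS addrK.
have pl := det2_plucker u (vtx P k - p) (edge P k') (edge P k).
have f1 : 0 <= det2 u (vtx P k - p) * det2 (edge P k') (edge P k).
  by rewrite mulr_ge0 // ltW.
have f2 : 0 <= det2 u (edge P k) * det2 (vtx P k - p) (edge P k').
  by rewrite mulr_ge0 // ltW.
have f3 : det2 u (edge P k') * det2 (vtx P k - p) (edge P k) <= 0.
  by rewrite mulr_le0_ge0 // ltW.
have /eqP : det2 u (edge P k) * det2 (vtx P k - p) (edge P k') = 0 by lra.
rewrite mulf_eq0 [X in _ || X]gt_eqF // orbF => /eqP z1.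
have /eqP : det2 u (edge P k') * det2 (vtx P k - p) (edge P k) = 0 by lra.
rewrite mulf_eq0 [X in _ || X]gt_eqF // orbF => /eqP z2.
exact: det2_basis z1 z2 (lt0r_neq0 D0).
Qed.

End ConvexPolygon.

(** * Chords through the interior *)
Section Chords.
Variables (R : realType) (n : nat).
Variable P : (n.*2).-tuple 'rV[R]_2.
Hypothesis hP : cppos P.
Implicit Types (i j k : nat) (p x y z u : 'rV[R]_2) (v w : 'rV[R]_3) (l m : P2 R).
Local Notation side := (side P).
Local Notation epoint := (epoint P).
Local Notation inner := (inner P).

Lemma ray_side k s p c u : epoint k s = p + c *: u ->
  side k p = c * det2 u (edge P k).
Proof.
move=> h; have := side_epoint_self P k s; rewrite h side_ray.
by rewrite (det2C u) => h'; lra.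
Qed.

(** A boundary point on a ray from an inner point lies on a line that leaves
    the half-plane of its side there, so no boundary point lies beyond it. *)
Lemma ray_bdry_le p u x y a c : inner p -> bdry P x -> bdry P y ->
  x = p + a *: u -> y = p + c *: u -> 0 < a -> 0 < c -> c <= a.
Proof.
move=> hp [i [s [_ ->]]] hy hx yE a0 c0.
have S := ray_side hx; have := side_bdry_ge0 hP i hy.
have Sp := hp i; rewrite yE side_ray S [det2 (edge P i) u]det2C.
have d0 : 0 < det2 u (edge P i) by move: Sp; rewrite S pmulr_rgt0.
by rewrite mulrN -mulrBl pmulr_lge0 // subr_ge0.
Qed.

Lemma ray_bdry_eq p u x y a c : inner p -> bdry P x -> bdry P y ->
  x = p + a *: u -> y = p + c *: u -> 0 < a * c -> a = c.
Proof.
move=> hp bx by_ hx hy ac.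
have [a0|a0|a0] := ltgtP a 0.
- have c0 : c < 0 by move: ac; rewrite nmulr_rgt0.
  have hx' : x = p + (- a) *: (- u) by rewrite scalerN scaleNr opprK.
  have hy' : y = p + (- c) *: (- u) by rewrite scalerN scaleNr opprK.
  have := ray_bdry_le hp bx by_ hx' hy'; have := ray_bdry_le hp by_ bx hy' hx'.
  by rewrite !oppr_gt0 => /(_ c0 a0) h1 /(_ a0 c0) h2; lra.
- have c0 : 0 < c by move: ac; rewrite pmulr_rgt0.
  by apply/le_anti; rewrite (ray_bdry_le hp bx by_ hx hy) ?
    (ray_bdry_le hp by_ bx hy hx).
- by move: ac; rewrite a0 mul0r ltxx.
Qed.

Lemma inner_not_bdry p : inner p -> ~ bdry P p.
Proof. by move=> hp [i [s [_ h]]]; have := hp i; rewrite h side_epoint_self ltxx. Qed.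

(** For boundary points this says that the open segment between them runs
    through the interior. *)
Definition transverse x y := forall k, ~ (side k x = 0 /\ side k y = 0).

Lemma transverseC x y : transverse x y -> transverse y x.
Proof. by move=> h k [h1 h2]; exact: (h k). Qed.

Lemma transverse_neq x y : bdry P x -> transverse x y -> x <> y.
Proof. by move=> /bdry_side[k hk] + xy; rewrite -xy => /(_ k); apply. Qed.

Lemma ray_on p u z : u != 0 -> det2 u (z - p) = 0 -> exists c, z = p + c *: u.
Proof. by move=> u0 /(det2_prop u0)[c h]; exists c; rewrite -h addrC subrK. Qed.

Lemma chord_through p u x y a b : inner p -> u != 0 ->
  bdry P x -> bdry P y -> x = p + a *: u -> y = p + b *: u -> a * b < 0 ->
  transverse x y /\ on (pclass (lin p u)) `&` bdry P = [set x; y].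
Proof.
move=> hp u0 bx by_ hx hy ab; split.
  move=> k; rewrite hx hy !side_ray => -[h1 h2].
  have S := hp k.
  have : 0 < (a * det2 (edge P k) u) * (b * det2 (edge P k) u).
    have -> : a * det2 (edge P k) u = - side k p by lra.
    have -> : b * det2 (edge P k) u = - side k p by lra.
    by rewrite mulrNN mulr_gt0.
  rewrite mulrACA ltNge => /negP; apply.
  by apply: mulr_le0_ge0; [exact: ltW|rewrite -expr2 sqr_ge0].
apply/seteqP; split=> z /=.
  move=> [/(on_lin _ _ u0) /(ray_on u0)[c hz] bz].
  have c0 : c != 0.
    apply/eqP => c0; apply: (inner_not_bdry hp); move: bz.
    by rewrite hz c0 scale0r addr0.
  have [ac|ac|ac] := ltgtP (a * c) 0.
  - right; rewrite hy hz; congr (_ + _ *: _).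
    apply: (ray_bdry_eq hp bz by_ hz hy).
    have a0 : a != 0 by apply: contraTneq ac => ->; rewrite mul0r ltxx.
    have : 0 < (a * c) * (a * b) by rewrite nmulr_lgt0.
    rewrite mulrACA pmulr_rgt0 //.
    by rewrite lt0r mulf_neq0 //= -expr2 sqr_ge0.
  - by left; rewrite hx hz (ray_bdry_eq hp bx bz hx hz).
  - move/eqP: ac; rewrite mulf_eq0 (negPf c0) orbF => /eqP a0.
    by move: ab; rewrite a0 mul0r ltxx.
move=> [->|->]; split => //; apply/on_lin => //.
  by rewrite hx addrC addKr det2Zr det2vv mulr0.
by rewrite hy addrC addKr det2Zr det2vv mulr0.
Qed.

Definition mid x y : 'rV[R]_2 := 2^-1 *: (x + y).

Lemma transverse_inner x y s : bdry P x -> bdry P y -> transverse x y ->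
  0 < s < 1 -> inner ((1 - s) *: x + s *: y).
Proof.
move=> bx by_ T /andP[s0 s1] k; rewrite side_comb.
have hx := side_bdry_ge0 hP k bx; have hy := side_bdry_ge0 hP k by_.
have s1' : 0 < 1 - s by rewrite subr_gt0.
move: hx; rewrite le_eqVlt => /orP[/eqP hx|hx]; last first.
  by rewrite ltr_pwDl ?mulr_gt0 // mulr_ge0 // ltW.
move: hy; rewrite le_eqVlt => /orP[/eqP hy|hy]; last first.
  by rewrite -hx mulr0 add0r mulr_gt0.
by case: (T k).
Qed.

Lemma mid_rays x y :
  (x = mid x y + (- 2^-1) *: (y - x)) * (y = mid x y + 2^-1 *: (y - x)).
Proof. by split; apply: row2P; rewrite !mxE; lra. Qed.

Lemma mid_inner x y : bdry P x -> bdry P y -> transverse x y ->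
  inner (mid x y).
Proof.
move=> bx by_ T; rewrite (_ : mid x y = (1 - 2^-1) *: x + 2^-1 *: y).
  by apply: transverse_inner => //; lra.
by apply: row2P; rewrite !mxE; lra.
Qed.

Lemma join_bdry x y : bdry P x -> bdry P y -> transverse x y ->
  on (join x y) `&` bdry P = [set x; y].
Proof.
move=> bx by_ T; have [h1 h2] := mid_rays x y.
have yx0 : y - x != 0.
  by rewrite subr_eq0; apply/eqP => /esym; exact: transverse_neq.
have [_ <-] := chord_through (mid_inner bx by_ T) yx0 bx by_ h1 h2 ltac:(lra).
rewrite joinE; congr (on (pclass _) `&` _).
by apply: row3P; rewrite !linE !mxE; field.
Qed.

Lemma set2_eq (T : Type) (x y x' y' : T) : [set x; y] = [set x'; y'] ->
  (x = x' /\ y = y') \/ (x = y' /\ y = x').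
Proof.
move=> h; have : [set x'; y'] x by rewrite -h; left.
have : [set x'; y'] y by rewrite -h; right.
have : [set x; y] x' by rewrite h; left.
have : [set x; y] y' by rewrite h; right.
by move=> /= [->|->] [->|->] [h1|h1] [h2|h2]; auto.
Qed.

Lemma Phi_eq l x y : x <> y -> on l `&` bdry P = [set x; y] ->
  Phi P l = join (sigma P x) (sigma P y).
Proof.
move=> xy h; apply: xget_unique; first by exists x, y.
move=> m [x' [y' [_ h' ->]]]; move: h'; rewrite h => h'.
by case: (set2_eq h') => -[-> ->]; [|exact: join_sym].
Qed.

Lemma Phi_join x y : bdry P x -> bdry P y -> transverse x y ->
  Phi P (join x y) = join (sigma P x) (sigma P y).
Proof.
move=> bx by_ T; apply: Phi_eq; first exact: transverse_neq.
exact: join_bdry.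
Qed.

Lemma transverse_sigma x y : bdry P x -> bdry P y -> transverse x y ->
  transverse (sigma P x) (sigma P y).
Proof.
move=> bx by_ T k [h1 h2]; apply: (T (k + n)%N); split.
  by rewrite -(sigmaK hP bx); apply: sigma_side => //; exact: bdry_sigma.
by rewrite -(sigmaK hP by_); apply: sigma_side => //; exact: bdry_sigma.
Qed.

Lemma transverse_self x : bdry P x -> transverse x (sigma P x).
Proof.
move=> bx k [h1 h2]; have := side_sigma_gt0 hP bx h1.
by rewrite h2 ltxx.
Qed.

(** Walking along the boundary, one leaves the positive half-plane of [v] on the
    [i]-th side. The inequalities are weak so that a line through a vertex exits
    along both adjacent sides; the entry side is an exit side of [- v]. *)
Definition exits v i := (0 <= ev v (vtx P i)) && (ev v (vtx P i.+1) <= 0).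

Lemma evN v x : ev (- v) x = - ev v x.
Proof. by rewrite !evE !mxE; ring. Qed.

Lemma linN p u : lin p (- u) = - lin p u.
Proof. by apply: row3P; rewrite [RHS]mxE !linE !mxE; ring. Qed.

Lemma exists_exit p u : inner p -> u != 0 -> exists i, exits (lin p u) i.
Proof.
move=> hp u0; have n1 := half_gt1 hP.
have Nu0 : - u != 0 by rewrite oppr_eq0.
have [i hi] := inner_sign hP hp Nu0.
have [j hj] := inner_sign hP hp u0.
rewrite -ev_lin linN evN oppr_lt0 in hi; rewrite -ev_lin in hj.
pose Q k := (i <= k)%N && (ev (lin p u) (vtx P k) <= 0).
have exQ : exists k, Q k.
  (* The same vertex as [j], with an index that is at least [i]. *)
  exists (j + i * n.*2)%N; rewrite /Q.
  have -> : vtx P (j + i * n.*2) = vtx P j by apply: vtx_mod; rewrite addnC modnMDl.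
  by rewrite (ltW hj) andbT; clear -n1; nia.
have := ex_minnP exQ => -[[|k] /andP[ik hk] kmin].
  by move: hk; rewrite leqn0 in ik; rewrite -(eqP ik) leNgt hi.
exists k; rewrite /exits hk andbT leNgt; apply/negP => hk'.
have ik' : (i <= k)%N.
  rewrite leqNgt; apply/negP => ki; have e : i = k.+1 by lia.
  by move: hk; rewrite -e leNgt hi.
by have := kmin k; rewrite /Q ik' (ltW hk') => /(_ isT); rewrite ltnn.
Qed.

(** The image of the exit point, up to a positive factor, in a form that is
    linear in the line. *)
Definition exit_image v i : 'rV[R]_3 :=
  ev v (vtx P i) *: hom (vtx P (i + n).+1)
  - ev v (vtx P i.+1) *: hom (vtx P (i + n)).

Lemma exit_imageN v i : exit_image (- v) i = - exit_image v i.
Proof. by rewrite /exit_image !evN !scaleNr opprK opprB addrC. Qed.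

Lemma exit_point p u i : inner p -> u != 0 -> exits (lin p u) i ->
  exists s a d, [/\ 0 <= s <= 1, a < 0, 0 < d, epoint i s = p + a *: u &
    exit_image (lin p u) i = d *: hom (epoint (i + n) s)].
Proof.
move=> hp u0 /andP[f0 f1]; set v := lin p u in f0 f1 *.
pose d := ev v (vtx P i) - ev v (vtx P i.+1).
have dE : d = - det2 u (edge P i).
  by rewrite /d !ev_lin vtxS !det2E !mxE; ring.
have d0 : 0 < d.
  rewrite lt0r subr_ge0 (le_trans f1 f0) andbT; apply/eqP => dz.
  have fz : ev v (vtx P i) = 0 by move: dz; rewrite /d; lra.
  rewrite ev_lin in fz; have [c hc] := ray_on u0 fz.
  have := hp i; rewrite (@ray_side i 0 p c u) ?epoint0 //.
  by move: dE; rewrite dz => dE; rewrite -[det2 _ _]opprK -dE oppr0 mulr0 ltxx.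
pose s := ev v (vtx P i) / d.
have sd : s * d = ev v (vtx P i) by rewrite /s divfK // gt_eqF.
have s01 : 0 <= s <= 1.
  by rewrite /s divr_ge0 // ?(ltW d0) //= ler_pdivrMr // mul1r /d; lra.
have : det2 u (epoint i s - p) = 0.
  by move: sd; rewrite dE /v ev_lin ?epointDE !det2E !mxE; lra.
move=> /(ray_on u0)[a ha]; exists s, a, d; split => //.
  have := hp i; rewrite (ray_side ha) -[det2 _ _]opprK -dE mulrN.
  by rewrite oppr_gt0 pmulr_llt0.
have f1E : ev v (vtx P i.+1) = s * d - d by rewrite sd /d; ring.
rewrite /exit_image -sd f1E.
by apply: row3P; rewrite !entryE !homE !extE ?vtxS ?epointDE ?entryE; ring.
Qed.

End Chords.

(** * Topology of the projective plane and of the polygon *)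
Section ContinuousOps.
Variables (R : realType) (T : topologicalType).

Lemma contD (V : normedModType R) (f g : T -> V) :
  continuous f -> continuous g -> continuous (fun x => f x + g x).
Proof. by move=> cf cg x; exact: (continuousD (cf x) (cg x)). Qed.

Lemma contM (f g : T -> R) :
  continuous f -> continuous g -> continuous (fun x => f x * g x).
Proof. by move=> cf cg x; exact: (continuousM (cf x) (cg x)). Qed.

Lemma contN (V : normedModType R) (f : T -> V) :
  continuous f -> continuous (fun x => - f x).
Proof. by move=> cf x; exact: (continuousN (cf x)). Qed.

Lemma contZ (V : normedModType R) (f : T -> R) (a : V) :
  continuous f -> continuous (fun x => f x *: a).
Proof. by move=> cf x; apply: (@cvgZr_tmp _ _ _ (nbhs x)); exact: cf. Qed.

Lemma cont_cst (V : topologicalType) (a : V) : continuous (fun _ : T => a).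
Proof. exact: cst_continuous. Qed.

End ContinuousOps.

Section ProjectiveTopology.
Variable R : realType.
Implicit Types (v w : 'rV[R]_3) (l : P2 R).

Lemma near_neq0 v : v != 0 -> \forall w \near v, w != 0.
Proof.
by move=> v0; apply: (@cvgr_neq0 _ _ _ (nbhs v) _ id v) => //; exact: cvg_id.
Qed.

(** Brings the quotient topology down to neighbourhoods in R^3: the nonzero
    vectors are open there. *)
Lemma P2_open (A : set (P2 R)) :
  open A <-> forall v, v != 0 -> A (pclass v) ->
    \forall w \near v, w != 0 -> A (pclass w).
Proof.
have valK (w : nzvec R) : pclass (\val w) = \pi_(P2 R)%qT w.
  by rewrite /pclass valKd.
split=> [[B oB BA] v v0 Av|h].
  have vin : v \in [set v : 'rV[R]_3 | v != 0] by rewrite inE.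
  have Bin w (w0 : w \in [set v : 'rV[R]_3 | v != 0]) : B w <-> A (pclass w).
    pose w' : nzvec R := exist _ w w0.
    have -> : pclass w = \pi_(P2 R)%qT w' by rewrite -valK.
    have -> : A (\pi_(P2 R)%qT w') = ((\pi_(P2 R)%qT : nzvec R -> _) @^-1` A) w' by [].
    by rewrite -BA.
  have : nbhs v B by apply: open_nbhs_nbhs; split => //; apply/Bin.
  by apply: filterS => w Bw w0; apply/Bin => //; rewrite inE.
exists [set w | w != 0 /\ A (pclass w)]; last first.
  apply/seteqP; split=> w /=; first by move=> [_]; rewrite -[set_val w]/(\val w) valK.
  move=> Aw; split; last by rewrite -[set_val w]/(\val w) valK.
  by have := valP w; rewrite inE.
rewrite openE => v [v0 Av]; rewrite /interior /=.
by apply: filterS2 (near_neq0 v0) (h v v0 Av) => w w0 hw; split => //; exact: hw.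
Qed.

Lemma entry_continuous (k : 'I_3) : continuous (fun v : 'rV[R]_3 => v 0 k).
Proof. by move=> v; exact: coord_continuous. Qed.

Lemma ev_continuous (x : 'rV[R]_2) : continuous (fun v : 'rV[R]_3 => ev v x).
Proof.
move=> v; rewrite (_ : (fun v : 'rV[R]_3 => ev v x) = (fun w : 'rV[R]_3 =>
    w 0 0 * x 0 0 + w 0 1 * x 0 1 + w 0 2)); last first.
  by apply/funext => w; rewrite evE.
move: v; apply: contD; last exact: entry_continuous.
by apply: contD; apply: contM; try exact: entry_continuous; exact: cont_cst.
Qed.

Lemma pclass_near v (A : set (P2 R)) : v != 0 -> nbhs (pclass v) A ->
  \forall w \near v, A (pclass w).
Proof.
move=> v0; rewrite nbhsE => -[B [oB Bv] BA].
by apply: filterS2 (near_neq0 v0) ((P2_open B).1 oB v v0 Bv) => w w0 /(_ w0)/BA.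
Qed.

Lemma pclass_continuous v : v != 0 -> {for v, continuous (@pclass R)}.
Proof. by move=> v0 A; exact: pclass_near. Qed.

End ProjectiveTopology.

Section Region.
Variables (R : realType) (n : nat).
Variable P : (n.*2).-tuple 'rV[R]_2.
Hypothesis hP : cppos P.
Implicit Types (i j k : nat) (p x y z u : 'rV[R]_2) (v w : 'rV[R]_3) (l m : P2 R).
Local Notation side := (side P).
Local Notation epoint := (epoint P).
Local Notation inner := (inner P).
Local Notation transverse := (transverse P).

Lemma region_vtx i : region P (vtx P i).
Proof. by move=> C [_ GC]; apply: GC; exists i. Qed.

Lemma region_comb s x y : 0 <= s <= 1 -> region P x -> region P y ->
  region P ((1 - s) *: x + s *: y).
Proof.
move=> /andP[s0 s1] rx ry C [cC GC].
have := cC y x (Itv01 s0 s1); rewrite !inE => /(_ (ry C (conj cC GC)) (rx C (conj cC GC))).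
by rewrite /conv /= addrC.
Qed.

Lemma region_epoint i s : 0 <= s <= 1 -> region P (epoint i s).
Proof. by move=> s01; rewrite epointE; apply: region_comb => //; exact: region_vtx. Qed.

Lemma bdry_region x : bdry P x -> region P x.
Proof. by move=> [i [s [s01 ->]]]; exact: region_epoint. Qed.

Lemma region_side i x : region P x -> 0 <= side i x.
Proof.
move=> rx; suff : region P `<=` [set x | 0 <= side i x] by apply.
apply: smallest_sub; last by move=> _ [j _ <-] /=; exact: side_vtx_ge0.
move=> y z t; rewrite !inE /= => hy hz.
have -> : conv t y z = (1 - t%:num) *: (z : 'rV[R]_2) + t%:num *: (y : 'rV[R]_2).
  exact: addrC.
by rewrite side_comb addr_ge0 // mulr_ge0 // subr_ge0.
Qed.

Lemma chord_of_exits p u i j : inner p -> u != 0 ->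
  exits P (lin p u) i -> exits P (- lin p u) j ->
  exists s t d e, [/\ 0 <= s <= 1, 0 <= t <= 1, 0 < d, 0 < e &
    [/\ transverse (epoint i s) (epoint j t),
       on (pclass (lin p u)) `&` bdry P = [set epoint i s; epoint j t],
       exists2 c, 0 < c < 1 & p = (1 - c) *: epoint i s + c *: epoint j t,
       exit_image P (lin p u) i = d *: hom (epoint (i + n) s) &
       exit_image P (lin p u) j = - e *: hom (epoint (j + n) t)]].
Proof.
move=> hp u0 ei ej.
have [s [a [d [s01 a0 d0 hs hd]]]] := exit_point hp u0 ei.
have Nu0 : - u != 0 by rewrite oppr_eq0.
rewrite -linN in ej; have [t [b [e [t01 b0 e0 ht he]]]] := exit_point hp Nu0 ej.
have ht' : epoint j t = p + (- b) *: u by rewrite ht scalerN scaleNr.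
have ab : a * - b < 0 by rewrite mulrN oppr_lt0 nmulr_rgt0.
exists s, t, d, e; split => //.
have [T E] := chord_through hP hp u0 (bdry_epoint P i s01) (bdry_epoint P j t01) hs ht' ab.
split => //.
  have ba : 0 < - b - a by lra.
  exists (- a / (- b - a)).
    by rewrite divr_gt0 ?oppr_gt0 //= ltr_pdivrMr // mul1r; lra.
  by rewrite hs ht'; apply: row2P; rewrite !mxE; field; lra.
by rewrite -[LHS]opprK -exit_imageN -linN he scaleNr.
Qed.

Lemma Phi_exits p u i j : inner p -> u != 0 ->
  exits P (lin p u) i -> exits P (- lin p u) j ->
  let L := cross (exit_image P (lin p u) i) (exit_image P (lin p u) j) in
  L != 0 /\ Phi P (pclass (lin p u)) = pclass L.
Proof.
move=> hp u0 ei ej.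
have [s [t [d [e [s01 t01 d0 e0 [T E _ hd he]]]]]] := chord_of_exits hp u0 ei ej.
have bs := bdry_epoint P i s01; have bt := bdry_epoint P j t01.
have T' := transverse_sigma hP bs bt T; rewrite !sigma_epoint // in T'.
have ne := transverse_neq (bdry_epoint P (i + n) s01) T'.
rewrite (Phi_eq (transverse_neq bs T) E) !sigma_epoint // /join.
rewrite hd he crossZl crossZr scalerA.
have c0 : d * - e != 0 by rewrite mulf_neq0 ?oppr_eq0 ?gt_eqF.
have L0 : cross (hom (epoint (i + n) s)) (hom (epoint (j + n) t)) != 0.
  by rewrite cross_hom lin_neq0 // subr_eq0; apply/eqP => /esym.
by split; [rewrite scaler_eq0 negb_or c0|rewrite pclassZ].
Qed.

Lemma exits_pair p u : inner p -> u != 0 ->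
  exists i j, exits P (lin p u) i /\ exits P (- lin p u) j.
Proof.
move=> hp u0; have [i ei] := exists_exit hP hp u0.
have Nu0 : - u != 0 by rewrite oppr_eq0.
have [j ej] := exists_exit hP hp Nu0; rewrite linN in ej.
by exists i, j.
Qed.

Lemma inner_chord p u : inner p -> u != 0 ->
  exists x y, [/\ bdry P x, bdry P y, transverse x y,
    pclass (lin p u) = join x y &
    exists2 c, 0 < c < 1 & p = (1 - c) *: x + c *: y].
Proof.
move=> hp u0; have [i [j [ei ej]]] := exits_pair hp u0.
have [s [t [d [e [s01 t01 d0 e0 [T E C hd he]]]]]] := chord_of_exits hp u0 ei ej.
exists (epoint i s), (epoint j t).
have bs := bdry_epoint P i s01; have bt := bdry_epoint P j t01.
split => //; apply: join_on; first exact: transverse_neq bs T.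
  have : [set epoint i s; epoint j t] (epoint i s) by left.
  by rewrite -E => -[].
have : [set epoint i s; epoint j t] (epoint j t) by right.
by rewrite -E => -[].
Qed.

Lemma ex_row2_neq0 : exists u : 'rV[R]_2, u != 0.
Proof. by exists (const_mx 1); rewrite row2_neq0 mxE oner_eq0. Qed.

Lemma inner_region p : inner p -> region P p.
Proof.
move=> hp; have [u u0] := ex_row2_neq0.
have [x [y [bx by_ T _ [c /andP[c0 c1] ->]]]] := inner_chord hp u0.
by apply: region_comb; [rewrite !ltW|exact: bdry_region|exact: bdry_region].
Qed.

Lemma side_continuous i : continuous (side i).
Proof.
move=> x; rewrite (_ : side i = (fun z : 'rV[R]_2 =>
    edge P i 0 0 * z 0 1 + - edge P i 0 1 * z 0 0 + - det2 (edge P i) (vtx P i))).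
  move: x; apply: contD; last exact: cont_cst.
  by apply: contD; apply: contM; try exact: cont_cst; move=> x; exact: coord_continuous.
by apply/funext => z; rewrite !sideE !det2E !mxE; ring.
Qed.

Lemma inner_near p : inner p -> \forall x \near p, inner x.
Proof.
move=> hp; have n1 := half_gt1 hP; have N0 : (0 < n.*2)%N by lia.
have : \forall x \near p, forall i : 'I_(n.*2), 0 < side i x.
  apply: (@filter_forall _ _ _ (nbhs p)) => i.
  by apply: (@cvgr_gt _ _ (nbhs p) _ (side i) (side i p)); [exact: side_continuous|exact: hp].
apply: filterS => x hx k; have := hx (Ordinal (ltn_pmod k N0)).
by rewrite (@side_mod _ _ P (k %% n.*2) k) //= modn_mod.
Qed.

(** A point on the line of a side can be pushed out of the polygon; a point
    inside all half-planes is a convex combination of the end points of a chord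
    through it, and this condition is open. *)
Lemma interior_region : (region P)° = inner.
Proof.
apply/seteqP; split => p; last first.
  by move=> /inner_near; apply: filterS; exact: inner_region.
move=> ip k; have := region_side k (interior_subset ip).
rewrite le_eqVlt => /orP[/eqP h|//]; exfalso.
set e := vtx P (k + n) - vtx P k.
have e0 : 0 < det2 (edge P k) e := side_opp_gt0 hP k.
have : \forall c \near (0 : R), region P (p + c *: e).
  have : (fun c : R => p + c *: e) c @[c --> 0] --> p + 0 *: e.
    by apply: cvgD; [exact: cvg_cst|apply: cvgZr_tmp; exact: cvg_id].
  by rewrite scale0r addr0 => /(_ _ ip).
move=> /nbhs_ballP[r /= r0 hr].
have := hr (- (r / 2)); rewrite /ball /= sub0r opprK gtr0_norm ?divr_gt0 //.
have r2 : r / 2 < r by lra.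
move=> /(_ r2)/(region_side k); rewrite side_ray -h add0r mulNr oppr_ge0 leNgt.
by rewrite mulr_gt0 // divr_gt0.
Qed.

Lemma band_lin p u : inner p -> u != 0 -> band P (pclass (lin p u)).
Proof.
move=> hp u0; exists p; split; last by rewrite interior_region.
by apply/on_lin => //; rewrite subrr det2r0.
Qed.

Lemma bandP l : band P l <-> exists p u, [/\ inner p, u != 0 & l = pclass (lin p u)].
Proof.
split=> [[p []]|[p [u [hp u0 ->]]]]; last exact: band_lin.
rewrite interior_region => /onE h hp.
have [u u0 hu] := ev_direction (hcoord_neq0 l) h.
by exists p, u; split => //; rewrite -hu hcoordK.
Qed.

Lemma band_chord l : band P l <->
  exists x y, [/\ bdry P x, bdry P y, transverse x y & l = join x y].
Proof.
split=> [/bandP[p [u [hp u0 ->]]]|[x [y [bx by_ T ->]]]].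
  by have [x [y [bx by_ T h _]]] := inner_chord hp u0; exists x, y.
apply/bandP; exists (mid x y), (y - x); split; first exact: (mid_inner hP).
  by rewrite subr_eq0; apply/eqP => /esym; exact: transverse_neq bx T.
rewrite joinE; congr pclass.
by apply: row3P; rewrite !linE !mxE; field.
Qed.

End Region.

(** * The involution on the lines that meet the interior *)
Section PhiBand.
Variables (R : realType) (n : nat).
Variable P : (n.*2).-tuple 'rV[R]_2.
Hypothesis hP : cppos P.
Implicit Types (i j k : nat) (p x y z u : 'rV[R]_2) (v w : 'rV[R]_3) (l m : P2 R).
Local Notation side := (side P).
Local Notation epoint := (epoint P).
Local Notation inner := (inner P).
Local Notation transverse := (transverse P).

Lemma Phi_band l : band P l -> band P (Phi P l).
Proof.
move=> /(band_chord hP)[x [y [bx by_ T ->]]]; rewrite (Phi_join hP) //.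
apply/(band_chord hP); exists (sigma P x), (sigma P y).
by split=> //; [exact: bdry_sigma|exact: bdry_sigma|exact: transverse_sigma].
Qed.

Lemma PhiK l : band P l -> Phi P (Phi P l) = l.
Proof.
move=> /(band_chord hP)[x [y [bx by_ T ->]]]; rewrite (Phi_join hP) //.
have bsx := bdry_sigma hP bx; have bsy := bdry_sigma hP by_.
by rewrite (Phi_join hP) // ?(sigmaK hP) //; exact: transverse_sigma.
Qed.

Lemma Phi_set_bij : set_bij (band P) (band P) (Phi P).
Proof.
split; first by move=> l /Phi_band.
  by move=> l m; rewrite !inE => hl hm h; rewrite -(PhiK hl) h PhiK.
by move=> l hl; exists (Phi P l); [exact: Phi_band|exact: PhiK].
Qed.

Lemma inner_comb s x y : 0 <= s <= 1 -> inner x -> inner y ->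
  inner ((1 - s) *: x + s *: y).
Proof.
move=> /andP[s0 s1] hx hy k; rewrite side_comb.
move: s0; rewrite le_eqVlt => /orP[/eqP <-|s0].
  by rewrite subr0 mul1r mul0r addr0.
have h1 : 0 <= (1 - s) * side k x by apply: mulr_ge0; [lra|exact: ltW (hx k)].
have h2 : 0 < s * side k y by rewrite mulr_gt0 ?hy.
lra.
Qed.

Lemma inner_mid p x : inner p -> bdry P x -> inner (mid p x).
Proof.
move=> hp bx k; have := hp k; have := side_bdry_ge0 hP k bx.
rewrite (_ : mid p x = (1 - 2^-1) *: p + 2^-1 *: x) ?side_comb; last first.
  by apply: row2P; rewrite !mxE; lra.
by move=> h1 h2; lra.
Qed.

Lemma ev_comb v s x y :
  ev v ((1 - s) *: x + s *: y) = (1 - s) * ev v x + s * ev v y.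
Proof. by rewrite !evE !mxE; ring. Qed.

Lemma ev_mid v x y : ev v (mid x y) = 2^-1 * (ev v x + ev v y).
Proof. by rewrite !evE !mxE; field. Qed.

(** The line crosses the segment between the two points. *)
Lemma band_of_signs v x y : inner x -> inner y -> 0 < ev v x -> ev v y < 0 ->
  v != 0 -> band P (pclass v).
Proof.
move=> hx hy fx fy v0; have d0 : 0 < ev v x - ev v y by lra.
pose s := ev v x / (ev v x - ev v y).
exists ((1 - s) *: x + s *: y); split; last first.
  rewrite (interior_region hP); apply: inner_comb => //.
  by rewrite divr_ge0 ?(ltW d0) ?(ltW fx) //= ler_pdivrMr // mul1r; lra.
by apply/on_pclass => //; rewrite ev_comb /s; field; lra.
Qed.

Lemma band_coord v : v != 0 -> band P (pclass v) ->
  exists p u, [/\ inner p, u != 0 & v = lin p u].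
Proof.
move=> v0 [p []]; rewrite (interior_region hP) => /on_pclass-/(_ v0) h hp.
by have [u u0 hu] := ev_direction v0 h; exists p, u.
Qed.

Lemma ev_near_gt v x c : c < ev v x -> \forall w \near v, c < ev w x.
Proof.
move=> h; apply: (@cvgr_gt _ _ (nbhs v) _ (fun w : 'rV[R]_3 => ev w x) (ev v x)) => //.
exact: ev_continuous.
Qed.

Lemma ev_near_lt v x c : ev v x < c -> \forall w \near v, ev w x < c.
Proof.
move=> h; apply: (@cvgr_lt _ _ (nbhs v) _ (fun w : 'rV[R]_3 => ev w x) (ev v x)) => //.
exact: ev_continuous.
Qed.

Lemma open_band : open (band P).
Proof.
apply/P2_open => v v0 /(band_coord v0)[p [u [hp u0 vE]]].
have Nu0 : - u != 0 by rewrite oppr_eq0.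
have [j hj] := inner_sign hP hp u0; have [i hi] := inner_sign hP hp Nu0.
have vp : ev v p = 0 by rewrite vE ev_lin subrr det2r0.
have b k : bdry P (vtx P k).
  by rewrite -epoint0; apply: bdry_epoint; rewrite lexx ler01.
have fi : 0 < ev v (mid p (vtx P i)).
  rewrite ev_mid vp add0r mulr_gt0 ?invr_gt0 // vE -oppr_lt0 -evN -linN ev_lin.
  exact: hi.
have fj : ev v (mid p (vtx P j)) < 0.
  by rewrite ev_mid vp add0r pmulr_rlt0 ?invr_gt0 // vE ev_lin; exact: hj.
apply: filterS2 (ev_near_gt fi) (ev_near_lt fj) => w wi wj w0.
by apply: band_of_signs wi wj w0; apply: inner_mid.
Qed.

Lemma exits_mod v i : exits P v (i %% n.*2) = exits P v i.
Proof.
rewrite /exits (@vtx_mod _ _ P (i %% n.*2) i) ?modn_mod //.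
by rewrite (@vtx_mod _ _ P (i %% n.*2).+1 i.+1) //; apply: modnS_eq; rewrite modn_mod.
Qed.

Lemma exit_image_continuous i : continuous (fun v => exit_image P v i).
Proof.
apply: contD; first by apply: contZ; exact: ev_continuous.
by apply: contN; apply: contZ; exact: ev_continuous.
Qed.

Lemma cont_cross (f g : 'rV[R]_3 -> 'rV[R]_3) : continuous f -> continuous g ->
  continuous (fun v => cross (f v) (g v)).
Proof.
move=> cf cg.
rewrite (_ : (fun v => _) = (fun v : 'rV[R]_3 =>
    (f v 0 1 * g v 0 2 + - (f v 0 2 * g v 0 1)) *: (delta_mx 0 0 : 'rV[R]_3) +
    (f v 0 2 * g v 0 0 + - (f v 0 0 * g v 0 2)) *: (delta_mx 0 1 : 'rV[R]_3) +
    (f v 0 0 * g v 0 1 + - (f v 0 1 * g v 0 0)) *: (delta_mx 0 2 : 'rV[R]_3))).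
  have ce (k : 'I_3) h : continuous h -> continuous (fun v : 'rV[R]_3 => (h v : 'rV[R]_3) 0 k).
    move=> ch v; apply: (@continuous_comp _ _ _ h (fun w : 'rV[R]_3 => w 0 k)).
      exact: ch.
    exact: entry_continuous.
  have cc (i j : 'I_3) : continuous (fun v => f v 0 i * g v 0 j + - (f v 0 j * g v 0 i)).
    by apply: contD; [|apply: contN]; apply: contM; exact: ce.
  by apply: contD; [apply: contD|]; apply: contZ; exact: cc.
by apply/funext => v; apply: row3P; rewrite crossE !mxE /=; ring.
Qed.

(** Near a line the exit sides can only be sides that it already (weakly)
    exits, so finitely many continuous formulas cover a neighbourhood, and they
    all give the same value at the line itself. *)
Lemma Phi_near v (V : set (P2 R)) i j : v != 0 -> band P (pclass v) -> open V ->
  V (Phi P (pclass v)) -> \forall w \near v, exits P w i -> exits P (- w) j ->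
    V (pclass (cross (exit_image P w i) (exit_image P w j))).
Proof.
move=> v0 bv oV Vv.
have notin (f : 'rV[R]_3 -> 'rV[R]_3) k : (f = id \/ f = -%R) -> ~~ exits P (f v) k ->
    \forall w \near v, ~~ exits P (f w) k.
  move=> fE; rewrite /exits negb_and -!ltNge => /orP[h|h].
    have : \forall w \near v, ev (f w) (vtx P k) < 0.
      case: fE h => ->; first exact: ev_near_lt.
      rewrite evN oppr_lt0 => /ev_near_gt; apply: filterS => w.
      by rewrite evN oppr_lt0.
    by apply: filterS => w hw; rewrite negb_and -!ltNge hw.
  have : \forall w \near v, 0 < ev (f w) (vtx P k.+1).
    case: fE h => ->; first exact: ev_near_gt.
    rewrite evN oppr_gt0 => /ev_near_lt; apply: filterS => w.
    by rewrite evN oppr_gt0.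
  by apply: filterS => w hw; rewrite negb_and -!ltNge hw orbT.
have [ei|ei] := boolP (exits P v i); last first.
  by apply: filterS (notin id i (or_introl erefl) ei) => w /negPf ->.
have [ej|ej] := boolP (exits P (- v) j); last first.
  by apply: filterS (notin -%R j (or_intror erefl) ej) => w /negPf -> _.
have [p [u [hp u0 vE]]] := band_coord v0 bv.
have := Phi_exits hP hp u0; rewrite -vE => /(_ i j ei ej)[L0 LE].
pose F w := cross (exit_image P w i) (exit_image P w j).
have cF : continuous F by apply: cont_cross; exact: exit_image_continuous.
have : \forall w' \near F v, V (pclass w').
  by apply: pclass_near => //; apply: open_nbhs_nbhs; split => //; rewrite -LE.
move=> h; have h' : \forall w \near v, V (pclass (F w)) := cF v _ h.
by apply: filterS h' => w Vw _ _.
Qed.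

Lemma Phi_continuous : {within band P, continuous (Phi P)}.
Proof.
apply: continuous_in_subspaceT => l; rewrite inE => bl V'.
rewrite nbhsE => -[V [oV Vl] VV'].
suff oA : open (band P `&` Phi P @^-1` V).
  by apply: filterS (open_nbhs_nbhs (conj oA (conj bl Vl))) => m [_ /VV'].
apply/P2_open => v v0 [bv Vv].
have n1 := half_gt1 hP; have N0 : (0 < n.*2)%N by lia.
have : \forall w \near v, forall ij : 'I_(n.*2) * 'I_(n.*2),
    exits P w ij.1 -> exits P (- w) ij.2 ->
    V (pclass (cross (exit_image P w ij.1) (exit_image P w ij.2))).
  by apply: (@filter_forall _ _ _ (nbhs v)) => ij; exact: Phi_near.
have nb := (P2_open (band P)).1 open_band v v0 bv.
apply: filterS2 nb => w bw hw w0; have {}bw := bw w0; split => //.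
have [p [u [hp u0 wE]]] := band_coord w0 bw.
have [i [j []]] := exits_pair hP hp u0.
rewrite -wE -(exits_mod w i) -(exits_mod (- w) j) => ei ej.
have := hw (Ordinal (ltn_pmod i N0), Ordinal (ltn_pmod j N0)) ei ej.
rewrite wE in ei ej *; rewrite /preimage /=.
by have [_ ->] := Phi_exits hP hp u0 ei ej.
Qed.

(** Corresponding points of opposite sides have the same parameter, so their
    midpoint is affine in it. *)
Lemma midpoint_locus : [set 2^-1 *: (x + sigma P x) | x in bdry P] = wigner P.
Proof.
have midE i s : 2^-1 *: (epoint i s + epoint (i + n) s) =
    (1 - s) *: midpt P i + s *: midpt P i.+1.
  by rewrite !epointE /midpt addSn; apply: row2P; rewrite !mxE; field.
apply/seteqP; split=> [_ [_ [i [s [s01 ->]]] <-]|_ [i [s s01 <-]]].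
  by exists i; exists s; rewrite ?in_itv //= -midE (sigma_epoint hP).
rewrite /= in_itv /= in s01.
by exists (epoint i s); [exact: bdry_epoint|rewrite (sigma_epoint hP) ?midE].
Qed.

End PhiBand.

(** * Affine covariance *)
Section AffineMaps.
Variable R : realType.
Variables (A : 'M[R]_2) (b : 'rV[R]_2).
Hypothesis Au : A \in unitmx.
Implicit Types (x y z u : 'rV[R]_2).
Local Notation F := (affmap A b).

Lemma det2_mul x y : det2 (x *m A) (y *m A) = \det A * det2 x y.
Proof.
have e01 : lift ord0 ord0 = 1 :> 'I_2 by exact: val_inj.
have e10 : lift (1 : 'I_2) ord0 = 0 :> 'I_2 by exact: val_inj.
rewrite (expand_det_row _ ord0) /cofactor !big_ord_recl !big_ord0 !det_mx11 /=.
rewrite !det2E !mxE !big_ord_recl !big_ord0 !e01 ?e10 /=.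
by rewrite /bump /= !expr0 !addr0 expr1; ring.
Qed.

Lemma det_neq0 : \det A != 0.
Proof. by move: Au; rewrite unitmxE unitfE. Qed.

Lemma affB x y : F x - F y = (x - y) *m A.
Proof. by rewrite /affmap mulmxBl opprD addrACA subrr addr0. Qed.

Lemma aff_comb s x y :
  F ((1 - s) *: x + s *: y) = (1 - s) *: F x + s *: F y.
Proof.
rewrite /affmap mulmxDl -!scalemxAl !scalerDr addrACA -scalerDl.
by rewrite subrK scale1r.
Qed.

Lemma aff_inj : injective F.
Proof.
move=> x y /eqP; rewrite -subr_eq0 affB => /eqP h.
apply/eqP; rewrite -subr_eq0; apply/eqP.
by rewrite -[x - y](mulmxK Au) h mul0mx.
Qed.

Lemma aff_surj z : exists x, F x = z.
Proof. by exists ((z - b) *m invmx A); rewrite /affmap mulmxKV // subrK. Qed.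

Lemma on_join_aff x y z : x <> y -> on (join (F x) (F y)) (F z) <-> on (join x y) z.
Proof.
move=> xy; have Fxy : F x <> F y by move=> /aff_inj.
rewrite !on_join // !affB det2_mul; split=> [/eqP|->]; last by rewrite mulr0.
by rewrite mulf_eq0 (negPf det_neq0) => /eqP.
Qed.

Lemma affline_join x y : x <> y -> affline A b (join x y) = join (F x) (F y).
Proof.
move=> xy; have Fxy : F x <> F y by move=> /aff_inj.
apply: xget_unique => /=.
  apply/seteqP; split=> [z|_ [z hz <-]]; last exact/on_join_aff.
  by have [z' <-] := aff_surj z; move=> /on_join_aff-/(_ xy) h; exists z'.
have onx w : w = x \/ w = y -> on (join x y) w.
  by move=> [->|->]; apply/on_join => //; rewrite ?det2vv // subrr det2r0.
by move=> m hm; apply: join_on => //; rewrite hm;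
  [exists x|exists y] => //; apply: onx; [left|right].
Qed.

End AffineMaps.

Section AffinePolygon.
Variables (R : realType) (n : nat).
Variable P : (n.*2).-tuple 'rV[R]_2.
Hypothesis hP : cppos P.
Variables (A : 'M[R]_2) (b : 'rV[R]_2).
Hypothesis Au : A \in unitmx.
Implicit Types (i j k : nat) (x y z u : 'rV[R]_2) (l m : P2 R).
Local Notation F := (affmap A b).
Local Notation P' := (affpoly A b P).

Lemma vtx_aff_pos i : 0 < \det A -> vtx P' i = F (vtx P i).
Proof.
move=> A0; have n1 := half_gt1 hP; have N0 : (0 < n.*2)%N by clear -n1; lia.
by rewrite /affpoly A0 /vtx (nth_map 0) // size_tuple ltn_mod.
Qed.

Lemma vtx_aff_neg i k : ~~ (0 < \det A) -> (i + k.+1 = 0 %[mod n.*2])%N ->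
  vtx P' i = F (vtx P k).
Proof.
move=> A0 e; have n1 := half_gt1 hP; have N0 : (0 < n.*2)%N by clear -n1; lia.
have iN := ltn_pmod i N0.
have rN : (n.*2 - (i %% n.*2).+1 < n.*2)%N by clear -N0; lia.
rewrite /affpoly (negPf A0) /vtx nth_rev ?size_tuple // (nth_map 0) ?size_tuple //.
suff -> : (k %% n.*2 = n.*2 - (i %% n.*2).+1)%N by [].
rewrite -[RHS](modn_small rN); apply/eqP.
have rE : (i.+1 + (n.*2 - (i %% n.*2).+1) = (i %/ n.*2).+1 * n.*2)%N.
  by rewrite {1}(divn_eq i n.*2) mulSn; clear -iN; lia.
by rewrite -(eqn_modDl i.+1) rE addSnnS e modnMl mod0n.
Qed.

(** The index [- i - 2] modulo [2 n], as [(2 n - 1) (i + 2)]: reversing the order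
    of the vertices turns the [i]-th side into this one, run backwards. *)
Lemma reflect_index i : exists k, (i + k.+2 = 0 %[mod n.*2])%N.
Proof.
have n1 := half_gt1 hP; exists ((n.*2.-1) * i.+2)%N.
rewrite (_ : _ + _ = i.+2 * n.*2)%N; last by clear -n1; nia.
by rewrite modnMl mod0n.
Qed.

Lemma epoint_aff_pos i s : 0 < \det A -> epoint P' i s = F (epoint P i s).
Proof. by move=> A0; rewrite !epointE aff_comb !vtx_aff_pos. Qed.

Lemma epoint_aff_neg i k s : ~~ (0 < \det A) -> (i + k.+2 = 0 %[mod n.*2])%N ->
  epoint P' i s = F (epoint P k (1 - s)).
Proof.
move=> A0 e; rewrite !epointE aff_comb.
rewrite (vtx_aff_neg A0 e) (@vtx_aff_neg i.+1 k A0) ?addSnnS //.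
by rewrite [LHS]addrC; congr (_ *: _ + _); ring.
Qed.

Lemma reflect_opp i k : (i + k.+2 = 0 %[mod n.*2])%N ->
  (i + n + (k + n).+2 = 0 %[mod n.*2])%N.
Proof.
by move=> e; rewrite -!addSn addnACA addnn modnDr.
Qed.

(** An orientation-reversing map runs through the opposite pairs of sides
    backwards; the opposite pairs themselves are preserved. *)
Lemma epoint_aff i s : 0 <= s <= 1 -> exists j t, [/\ 0 <= t <= 1,
  epoint P' i s = F (epoint P j t) & epoint P' (i + n) s = F (epoint P (j + n) t)].
Proof.
move=> /andP[s0 s1]; have [A0|A0] := boolP (0 < \det A).
  by exists i, s; rewrite s0 s1 !epoint_aff_pos.
have [k e] := reflect_index i; exists k, (1 - s).
split; first (by apply/andP; split; lra); apply: epoint_aff_neg => //.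
exact: reflect_opp.
Qed.

Lemma epoint_aff_inv j t : 0 <= t <= 1 -> exists i s, [/\ 0 <= s <= 1,
  epoint P' i s = F (epoint P j t) & epoint P' (i + n) s = F (epoint P (j + n) t)].
Proof.
move=> /andP[t0 t1]; have [A0|A0] := boolP (0 < \det A).
  by exists j, t; rewrite t0 t1 !epoint_aff_pos.
have [k e] := reflect_index j; exists k, (1 - t).
have e' : (k + j.+2 = 0 %[mod n.*2])%N by rewrite addnC addSnnS addSnnS.
split; first (by apply/andP; split; lra).
  by rewrite (epoint_aff_neg _ A0 e') opprB addrC subrK.
by rewrite (epoint_aff_neg _ A0 (reflect_opp e')) opprB addrC subrK.
Qed.

Lemma cppos_aff : cppos P'.
Proof.
have n1 := half_gt1 hP.
have c1 i j : j != i %[mod n.*2] -> j != i.+1 %[mod n.*2] ->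
    0 < det2 (edge P' i) (vtx P' j - vtx P' i).
  move=> ji ji1; have [A0|A0] := boolP (0 < \det A).
    rewrite /edge !vtx_aff_pos // !affB det2_mul mulr_gt0 //.
    by case: hP => h _ _; exact: h.
  have [k e] := reflect_index i; have [m' e'] := reflect_index j.
  have e1 : (i.+1 + k.+1 = 0 %[mod n.*2])%N by rewrite addSnnS.
  rewrite /edge (vtx_aff_neg A0 e) (vtx_aff_neg A0 e1) (vtx_aff_neg A0 e') !affB.
  rewrite det2_mul vtxS.
  have -> : det2 (vtx P k - (vtx P k + edge P k)) (vtx P m'.+1 - (vtx P k + edge P k))
      = - side P k (vtx P m'.+1).
    by rewrite /side !det2E !mxE; ring.
  rewrite mulrN oppr_gt0 nmulr_rlt0; last first.
    by rewrite lt_neqAle (det_neq0 Au) leNgt.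
  apply: side_vtx_gt0 => // /eqP.
    move=> /eqP h; move/eqP: ji1; apply; apply/eqP.
    rewrite -(eqn_modDr k.+1) e1 -(modnDmr j) -addn1 -(modnDml k) -h modnDml.
    by rewrite addn1 modnDmr e'.
  move=> /eqP h; move/eqP: ji; apply; apply/eqP.
  by rewrite -(eqn_modDr k.+2) e -(modnDmr j) -(modnS_eq h) modnDmr e'.
split => // i.
  have ne k : (k < 2)%N -> ((i + 2)%N != i + k %[mod n.*2])%N.
    by move=> k2; apply/eqP/neq_mod_small => //; clear -n1; lia.
  have ne0 : ((i + 2)%N != i %[mod n.*2])%N by have := ne 0%N isT; rewrite addn0.
  have ne1 : ((i + 2)%N != i.+1 %[mod n.*2])%N by have := ne 1%N isT; rewrite addn1.
  have := c1 i (i + 2)%N ne0 ne1; rewrite addn2 !vtxS => h.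
  rewrite gt_eqF //; move: h; rewrite !det2E !mxE; lra.
have [A0|A0] := boolP (0 < \det A).
  rewrite /edge !vtx_aff_pos // !affB det2_mul.
  by case: hP => _ _ h; rewrite -/(edge P i) -/(edge P (i + n)) h mulr0.
have [k e] := reflect_index i; have e' := reflect_opp e.
have e1 : (i.+1 + k.+1 = 0 %[mod n.*2])%N by rewrite addSnnS.
have e1' : ((i + n).+1 + (k + n).+1 = 0 %[mod n.*2])%N by rewrite addSnnS.
rewrite /edge (vtx_aff_neg A0 e) (vtx_aff_neg A0 e') (vtx_aff_neg A0 e1).
rewrite (vtx_aff_neg A0 e1') !affB det2_mul.
rewrite -(opprB (vtx P k.+1)) -(opprB (vtx P (k + n).+1)) det2Nr det2C det2Nr opprK.
by case: hP => _ _ h; rewrite -det2C -/(edge P k) -/(edge P (k + n)) h mulr0.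
Qed.

Lemma bdry_aff x : bdry P' (F x) <-> bdry P x.
Proof.
split=> -[i [s [s01 h]]].
  have [j [t [t01 e _]]] := epoint_aff i s01.
  by exists j, t; split => //; apply: (aff_inj (b := b) Au); rewrite h -/(epoint _ _ _) e.
have [j [t [t01 e _]]] := epoint_aff_inv i s01.
by exists j, t; split => //; rewrite h -/(epoint _ _ _) -e.
Qed.

Lemma sigma_aff x : bdry P x -> sigma P' (F x) = F (sigma P x).
Proof.
move=> [i [s [s01 ->]]]; rewrite -/(epoint _ _ _) (sigma_epoint hP) //.
have [j [t [t01 <- <-]]] := epoint_aff_inv i s01.
exact: sigma_epoint cppos_aff _ _ _.
Qed.

Lemma Phi_aff l : band P l -> Phi P' (affline A b l) = affline A b (Phi P l).
Proof.
move=> /(band_chord hP)[x [y [bx by_ T ->]]]; rewrite (Phi_join hP) //.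
have xy := transverse_neq bx T.
have sxy := transverse_neq (bdry_sigma hP bx) (transverse_sigma hP bx by_ T).
rewrite !affline_join // (@Phi_eq _ _ _ _ (F x) (F y)) ?sigma_aff //.
  by move=> /(aff_inj Au).
have E := join_bdry hP bx by_ T.
apply/seteqP; split=> [z|z [->|->]].
- have [z' <-] := aff_surj b Au z.
  move=> [/(on_join_aff _ Au _ xy) h /bdry_aff h'].
  have : [set x; y] z' by rewrite -E.
  by move=> [->|->]; [left|right].
- by split; [apply/on_join_aff => //; apply/on_join => //; rewrite subrr det2r0
            |apply/bdry_aff].
- by split; [apply/on_join_aff => //; apply/on_join => //; rewrite det2vv
            |apply/bdry_aff].
Qed.

End AffinePolygon.

(** * Envelopes and smooth lifts *)
Section Calculus.
Variable R : realType.
Implicit Types (L M : R -> 'rV[R]_3) (g : R -> P2 R) (t s : R) (D : set R).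

Lemma entry_is_derive L t k : derivable L t 1 ->
  is_derive t 1 (fun s => L s 0 k) (derive1 L t 0 k).
Proof.
move=> dL; have dk : derivable (fun s => L s 0 k) t 1 := (derivable_mxP L t 1).1 dL 0 k.
by apply: (DeriveDef dk); rewrite derive1E (derive_mx dL) mxE.
Qed.

Lemma is_derive_entries L (d : 'rV[R]_3) t :
  (forall k, is_derive t 1 (fun s => L s 0 k) (d 0 k)) ->
  derivable L t 1 /\ derive1 L t = d.
Proof.
move=> h; have dL : derivable L t 1.
  by apply/derivable_mxP => i k; rewrite (ord1 i); have [] := h k.
split => //; rewrite derive1E (derive_mx dL); apply/rowP => k.
by rewrite mxE; have [] := h k.
Qed.

Lemma smooth_derivable L t : smooth L -> derivable L t 1.
Proof. by move=> /(_ 0%N t). Qed.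

(** All lifts needed below belong to families that differentiation maps to
    themselves, so that one derivative gives them all. *)
Lemma smooth_family (I : Type) (F : I -> R -> 'rV[R]_3) (d : I -> I) :
  (forall i t k, is_derive t 1 (fun s => F i s 0 k) (F (d i) t 0 k)) ->
  forall i, smooth (F i) /\ forall t, derive1 (F i) t = F (d i) t.
Proof.
move=> h i; have hd j t := is_derive_entries (h j t).
split; last by move=> t; have [] := hd i t.
suff e k : derive1n k (F i) = F (iter k d i) by move=> k t; rewrite e; have [] := hd (iter k d i) t.
elim: k => // k ih; rewrite derive1nS ih; apply/funext => t.
by have [_ ->] := hd (iter k d i) t; rewrite iterS.
Qed.

(** Covers the two closed half-lines and the whole line at once; the sign of
    [sg] is the side. *)
Definition one_sided D t := exists2 sg : R, sg != 0 & forall e, 0 <= e -> D (t + e * sg).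

Lemma one_sided_le t : one_sided [set s | s <= t] t.
Proof.
exists (-1); first by rewrite oppr_eq0 oner_eq0.
by move=> e e0 /=; rewrite mulrN1 gerBl.
Qed.

Lemma one_sided_ge t : one_sided [set s | t <= s] t.
Proof. by exists 1; [exact: oner_neq0|move=> e e0 /=; rewrite mulr1 lerDl]. Qed.

Lemma one_sidedT t : one_sided setT t.
Proof. by exists 1; [exact: oner_neq0|]. Qed.

Lemma one_sided_derive0 D t (h : R -> R) d : one_sided D t ->
  (\forall s \near within D (nbhs t), h s = 0) -> is_derive t 1 h d -> d = 0.
Proof.
move=> [sg sg0 hD] /nbhs_ballP[r /= r0 hr] [dh dhE].
have ht : h t = 0.
  by apply: hr; [exact: ballxx|have := hD 0 (lexx 0); rewrite mul0r addr0].
apply/eqP/negP => /negP d0; pose q e := e^-1 *: ((h \o shift t) (e *: 1) - h t).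
have : q e @[e --> 0^'] --> d by rewrite -dhE; exact: dh.
have nd0 : 0 < `|d| by rewrite normr_gt0.
move=> /cvgrPdist_lt /(_ _ nd0) /nbhs_ballP[r' /= r'0 hr'].
have [e e0 [er er']] : exists2 e : R, 0 < e & `|e * sg| < r /\ `|e * sg| < r'.
  exists (Num.min r r' / 2 / `|sg|).
    by rewrite divr_gt0 ?normr_gt0 // divr_gt0 // lt_min r0.
  rewrite normrM [X in X * _]gtr0_norm; last first.
    by rewrite divr_gt0 ?normr_gt0 // divr_gt0 // lt_min r0.
  rewrite divfK ?normr_eq0 //.
  have m0 : 0 < Num.min r r' by rewrite lt_min r0.
  have : Num.min r r' <= r by rewrite ge_min lexx.
  have : Num.min r r' <= r' by rewrite ge_min lexx orbT.
  by move=> h1 h2; split; lra.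
have hs : h (t + e * sg) = 0.
  apply: hr; last exact: hD (ltW e0).
  by rewrite /ball /= opprD addNKr normrN.
have := hr' (e * sg); rewrite /ball /= sub0r normrN => /(_ er').
rewrite mulf_neq0 // ?gt_eqF // => /(_ isT).
have -> : q (e * sg) = 0.
  rewrite /q /= /shift /= (_ : (e * sg)%:A = e * sg); last by rewrite /GRing.scale /= mulr1.
  by rewrite [e * sg + t]addrC hs ht subrr scaler0.
by rewrite subr0 ltxx.
Qed.

(** One-sided envelope points do not depend on the lift: two lifts [L], [M] are
    proportional, so [cross L M] vanishes on the half-line, and so does its
    derivative; this makes the two Wronskians proportional. *)
Lemma envelope_eq g D t q M : one_sided D t -> envelope g D t q ->
  derivable M t 1 -> (\forall s \near within D (nbhs t), lifts g M s) ->
  wronsk M t != 0 -> q = pclass (wronsk M t).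
Proof.
move=> oD [L [sL hL wL ->]] dM hM wM.
have dL : derivable L t 1 := smooth_derivable sL.
have hLM : \forall s \near within D (nbhs t), cross (L s) (M s) = 0.
  apply: filterS2 hL hM => s [L0 gL] [M0 gM].
  have [c _ ->] : exists2 c, c != 0 & L s = c *: M s.
    by apply: pclass_prop => //; rewrite -gL -gM.
  by rewrite crossZl crossvv scaler0.
have z : cross (derive1 L t) (M t) + cross (L t) (derive1 M t) = 0.
  have dLk k := entry_is_derive k dL; have dMk k := entry_is_derive k dM.
  (* The hypothesis on [k] is met by the three cyclic choices of [i], [j], [k]. *)
  have main (i j : 'I_3) (k : 'I_3) :
      (forall v w : 'rV[R]_3, cross v w 0 k = v 0 i * w 0 j - v 0 j * w 0 i) ->
      (cross (derive1 L t) (M t) + cross (L t) (derive1 M t)) 0 k = 0.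
    move=> ck; apply: (one_sided_derive0 (h := fun s => cross (L s) (M s) 0 k) oD).
      by apply: filterS hLM => s ->; rewrite mxE.
    rewrite (_ : (fun s => _) = (fun s => L s 0 i) * (fun s => M s 0 j)
                              - (fun s => L s 0 j) * (fun s => M s 0 i)).
      apply: is_derive_eq; rewrite entryE !ck /GRing.scale /=; ring.
    by apply/funext => s; rewrite ck.
  apply: row3P; rewrite [RHS]mxE.
  - by apply: (main 1 2 0); exact: cross0.
  - by apply: (main 2 0 1); exact: cross1.
  - by apply: (main 0 1 2); exact: cross2.
have tD : D t by case: oD => sg _ /(_ 0 (lexx 0)); rewrite mul0r addr0.
have [L0 gL] := nbhs_singleton hL tD; have [M0 gM] := nbhs_singleton hM tD.
have [c c0 LM] : exists2 c, c != 0 & L t = c *: M t.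
  by apply: pclass_prop => //; rewrite -gL -gM.
have wLM : wronsk L t = c ^+ 2 *: wronsk M t.
  have := z; rewrite [X in X + _]crossC LM crossZl => /eqP.
  rewrite addrC subr_eq0 => /eqP z'.
  by rewrite /wronsk LM crossZl -z' scalerA expr2.
by rewrite wLM pclassZ // expf_neq0.
Qed.

Lemma envelope_lift g D t M : smooth M ->
  (\forall s \near within D (nbhs t), lifts g M s) -> wronsk M t != 0 ->
  envelope g D t (pclass (wronsk M t)).
Proof. by move=> sM hM wM; exists M. Qed.

(** The lines that turn about a fixed point while another one moves uniformly
    along a side. *)
Definition aff_curve (AB : 'rV[R]_3 * 'rV[R]_3) t := AB.1 + t *: AB.2.

Lemma smooth_aff AB : smooth (aff_curve AB) /\
  forall t, derive1 (aff_curve AB) t = aff_curve (AB.2, 0) t.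
Proof.
apply: (@smooth_family _ aff_curve (fun AB => (AB.2, 0))) => {}AB t k.
rewrite (_ : (fun s => _) = cst (AB.1 0 k) + id * cst (AB.2 0 k)).
  apply: (is_derive_eq (is_deriveD (is_derive_cst _ _ _)
    (is_deriveM (is_derive_id _ _) (is_derive_cst _ _ _)))).
  rewrite /aff_curve /= !entryE mxE /GRing.scale /=.
  by ring.
by apply/funext => s; rewrite /aff_curve !entryE.
Qed.

(** The pencils. *)
Definition trig_curve (VW : 'rV[R]_3 * 'rV[R]_3) t := cos t *: VW.1 + sin t *: VW.2.

Lemma smooth_trig VW : smooth (trig_curve VW) /\
  forall t, derive1 (trig_curve VW) t = trig_curve (VW.2, - VW.1) t.
Proof.
apply: (@smooth_family _ trig_curve (fun VW => (VW.2, - VW.1))) => {}VW t k.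
rewrite (_ : (fun s => _) = cos * cst (VW.1 0 k) + sin * cst (VW.2 0 k)).
  apply: (is_derive_eq (is_deriveD (is_deriveM (is_derive_cos t) (is_derive_cst _ _ _))
    (is_deriveM (is_derive_sin t) (is_derive_cst _ _ _)))).
  rewrite /trig_curve /= !entryE /GRing.scale /=.
  by ring.
by apply/funext => s; rewrite /trig_curve !entryE.
Qed.

(** The image of a pencil within a cell, and its envelope. *)
Definition quad_curve (Q : 'rV[R]_3 * 'rV[R]_3 * 'rV[R]_3) t :=
  cos t ^+ 2 *: Q.1.1 + (cos t * sin t) *: Q.1.2 + sin t ^+ 2 *: Q.2.

Lemma smooth_quad Q : smooth (quad_curve Q) /\ forall t,
  derive1 (quad_curve Q) t = quad_curve (Q.1.2, 2 *: (Q.2 - Q.1.1), - Q.1.2) t.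
Proof.
apply: (@smooth_family _ quad_curve
  (fun Q => (Q.1.2, 2 *: (Q.2 - Q.1.1), - Q.1.2))) => {}Q t k.
rewrite (_ : (fun s => _) = cos * cos * cst (Q.1.1 0 k)
  + cos * sin * cst (Q.1.2 0 k) + sin * sin * cst (Q.2 0 k)).
  have dc := is_derive_cos t; have ds := is_derive_sin t.
  apply: (is_derive_eq (is_deriveD (is_deriveD
    (is_deriveM (is_deriveM dc dc) (is_derive_cst _ _ _))
    (is_deriveM (is_deriveM dc ds) (is_derive_cst _ _ _)))
    (is_deriveM (is_deriveM ds ds) (is_derive_cst _ _ _)))).
  rewrite /quad_curve /= !entryE /GRing.scale /=.
  by ring.
by apply/funext => s; rewrite /quad_curve !entryE.
Qed.

Lemma wronsk_aff AB t : wronsk (aff_curve AB) t = cross AB.1 AB.2.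
Proof.
rewrite /wronsk (smooth_aff AB).2 /aff_curve /= scaler0 addr0.
by apply: row3P; rewrite !crossE !entryE; ring.
Qed.

Lemma wronsk_trig VW t : wronsk (trig_curve VW) t = cross VW.1 VW.2.
Proof.
rewrite /wronsk (smooth_trig VW).2.
rewrite -[RHS]scale1r -(cos2Dsin2 t) /trig_curve /=.
by apply: row3P; rewrite [RHS]entryE !crossE !entryE; ring.
Qed.

Definition quad_wronsk (Q : 'rV[R]_3 * 'rV[R]_3 * 'rV[R]_3) :=
  (cross Q.1.1 Q.1.2, 2 *: cross Q.1.1 Q.2, cross Q.1.2 Q.2).

Lemma wronsk_quad Q t : wronsk (quad_curve Q) t = quad_curve (quad_wronsk Q) t.
Proof.
transitivity ((cos t ^+ 2 + sin t ^+ 2) *: quad_curve (quad_wronsk Q) t); last first.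
  by rewrite cos2Dsin2 scale1r.
rewrite /wronsk (smooth_quad Q).2 /quad_curve /quad_wronsk /=.
by apply: row3P; rewrite !(crossE, entryE); ring.
Qed.

End Calculus.

(** * The image of a pencil of lines *)
Section DualOfPencil.
Variables (R : realType) (n : nat).
Variable P : (n.*2).-tuple 'rV[R]_2.
Hypothesis hP : cppos P.
Implicit Types (i j k : nat) (p x y z u : 'rV[R]_2) (v w : 'rV[R]_3).
Implicit Types (s t : R).
Local Notation side := (side P).
Local Notation epoint := (epoint P).
Local Notation inner := (inner P).
Local Notation transverse := (transverse P).

Definition dir t : 'rV[R]_2 := \row_(k < 2) (if k == 0 then cos t else sin t).
Definition dir' t : 'rV[R]_2 := \row_(k < 2) (if k == 0 then - sin t else cos t).

Lemma dirE t : (dir t 0 0 = cos t) * (dir t 0 1 = sin t).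
Proof. by rewrite !mxE. Qed.

Lemma dir'E t : (dir' t 0 0 = - sin t) * (dir' t 0 1 = cos t).
Proof. by rewrite !mxE. Qed.

Lemma dir_neq0 t : dir t != 0.
Proof.
rewrite row2_neq0 !dirE -negb_and; apply/negP => /andP[/eqP c0 /eqP s0].
by have := cos2Dsin2 t; rewrite c0 s0 expr0n addr0 => /eqP; rewrite eq_sym oner_eq0.
Qed.

Definition plin p t := lin p (dir t).

Lemma pencilE p t : pencil p t = pclass (plin p t).
Proof. by rewrite /pencil joinE addrC addKr. Qed.

Lemma det2_dir t : det2 (dir t) (dir' t) = 1.
Proof. by rewrite det2E !dirE !dir'E mulrN opprK -!expr2 cos2Dsin2. Qed.

(** A lift of the image of the pencil as long as the line of angle [t] crosses
    the [i]-th and the [j]-th sides. *)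
Definition glift p i j t := cross (exit_image P (plin p t) i) (exit_image P (plin p t) j).

Definition gpair p i : 'rV[R]_3 * 'rV[R]_3 :=
  (exit_image P (lin p (\row_k (k == 0)%:R)) i,
   exit_image P (lin p (\row_k (k == 1)%:R)) i).

Lemma exit_image_trig p i t : exit_image P (plin p t) i = trig_curve (gpair p i) t.
Proof.
rewrite /exit_image /trig_curve /gpair /exit_image /plin !ev_lin !det2E !dirE.
by apply: row3P; rewrite !entryE !mxE /=; ring.
Qed.

Definition gquad p i j : 'rV[R]_3 * 'rV[R]_3 * 'rV[R]_3 :=
  let a := gpair p i in let b := gpair p j in
  (cross a.1 b.1, cross a.1 b.2 + cross a.2 b.1, cross a.2 b.2).

Lemma glift_quad p i j : glift p i j = quad_curve (gquad p i j).
Proof.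
apply/funext => t; rewrite /glift !exit_image_trig /quad_curve /gquad /trig_curve.
move: (gpair p i) (gpair p j) => [a a'] [c c'] /=.
by apply: row3P; rewrite !(crossE, entryE); ring.
Qed.

Lemma derive_glift p i j t : derive1 (glift p i j) t =
  cross (exit_image P (lin p (dir' t)) i) (exit_image P (plin p t) j)
  + cross (exit_image P (plin p t) i) (exit_image P (lin p (dir' t)) j).
Proof.
have e k : exit_image P (lin p (dir' t)) k =
    trig_curve ((gpair p k).2, - (gpair p k).1) t.
  rewrite /exit_image /trig_curve /gpair /exit_image !ev_lin !det2E !dir'E.
  by apply: row3P; rewrite !entryE !mxE /=; ring.
rewrite glift_quad (smooth_quad _).2 !e !exit_image_trig.
rewrite /quad_curve /gquad /trig_curve; move: (gpair p i) (gpair p j) => [a a'] [c c'] /=.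
by apply: row3P; rewrite !(crossE, entryE); ring.
Qed.

(** For a line spanned by two moving points [X] and [Y] this is the Wronskian,
    which divides them according to the speeds at which each turns. *)
Lemma cross_wronsk (X Y X' Y' : 'rV[R]_3) :
  cross (cross X Y) (cross X' Y + cross X Y') =
  dot X (cross Y Y') *: X + dot Y (cross X X') *: Y.
Proof. by rewrite /dot; apply: row3P; rewrite !(crossE, entryE); ring. Qed.

(** The image of a crossing point moves along the opposite side, at a speed
    proportional to the distance from [p] to the side: this is the Pluecker
    relation. *)
Lemma cross_exit_image p i t :
  cross (exit_image P (plin p t) i) (exit_image P (lin p (dir' t)) i) =
  side i p *: lin (vtx P (i + n)) (edge P (i + n)).
Proof.
rewrite -[side i p]mul1r -(det2_dir t) /exit_image /plin !ev_lin !vtxS !sideE.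
rewrite !det2E; move: (dir t) (dir' t) (edge P (i + n)) => u u' e.
by apply: row3P; rewrite !(crossE, entryE, linE) ?homE ?extE !entryE; ring.
Qed.

Lemma wronsk_glift p i j t : wronsk (glift p i j) t =
  (side j p * dot (exit_image P (plin p t) i) (lin (vtx P (j + n)) (edge P (j + n))))
     *: exit_image P (plin p t) i +
  (side i p * dot (exit_image P (plin p t) j) (lin (vtx P (i + n)) (edge P (i + n))))
     *: exit_image P (plin p t) j.
Proof.
rewrite /wronsk derive_glift {1}/glift cross_wronsk !cross_exit_image.
by rewrite /dot !entryE; congr (_ *: _ + _ *: _); ring.
Qed.

Lemma wronsk_gliftC p i j t : wronsk (glift p i j) t = wronsk (glift p j i) t.
Proof. by rewrite !wronsk_glift addrC. Qed.

Lemma gliftC p i j t : glift p i j t = - glift p j i t.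
Proof. by rewrite /glift crossC. Qed.

Lemma Gamma_exits p i j t : inner p ->
  exits P (plin p t) i -> exits P (- plin p t) j -> lifts (Gamma P p) (glift p i j) t.
Proof.
by move=> hp ei ej; rewrite /lifts /Gamma pencilE; apply: Phi_exits => //; exact: dir_neq0.
Qed.

(** Both coefficients of [wronsk_glift] are positive: [p] is inside, and neither
    end point of the image chord is on the line of the side of the other. *)
Lemma wronsk_exits p i j t : inner p ->
  exits P (plin p t) i -> exits P (- plin p t) j ->
  exists x y c, [/\ bdry P x, bdry P y, 0 < c < 1, wronsk (glift p i j) t != 0 &
    pclass (wronsk (glift p i j) t) = pt ((1 - c) *: x + c *: y)].
Proof.
move=> hp ei ej; have u0 := dir_neq0 t.
have [s [r [d [e [s01 r01 d0 e0 [T E _ hd he]]]]]] := chord_of_exits hP hp u0 ei ej.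
have bs := bdry_epoint P i s01; have br := bdry_epoint P j r01.
have T' := transverse_sigma hP bs br T; rewrite !sigma_epoint // in T'.
have bs' := bdry_epoint P (i + n) s01; have br' := bdry_epoint P (j + n) r01.
set x := epoint (i + n) s in bs' T'; set y := epoint (j + n) r in br' T'.
have dl a z k : dot (a *: hom z) (lin (vtx P k) (edge P k)) = a * side k z.
  by rewrite !sideE -ev_lin evE /dot !entryE homE !extE; ring.
have pos k z z' : bdry P z' -> side k z = 0 -> transverse z z' -> 0 < side k z'.
  move=> bz hz T1; rewrite lt_neqAle (side_bdry_ge0 hP k bz) andbT eq_sym.
  by apply/negP => /eqP hz'; exact: (T1 k).
have a0 : 0 < side (j + n) x.
  exact: pos bs' (side_epoint_self _ _ _) (transverseC T').
have b0 : 0 < side (i + n) y := pos _ _ _ br' (side_epoint_self _ _ _) T'.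
have WE : wronsk (glift p i j) t = (d ^+ 2 * side j p * side (j + n) x) *: hom x
    + (e ^+ 2 * side i p * side (i + n) y) *: hom y.
  rewrite wronsk_glift /plin hd he !dl !scalerA; congr (_ *: _ + _ *: _); ring.
set a := d ^+ 2 * _ * _ in WE; set b := e ^+ 2 * _ * _ in WE.
have {}a0 : 0 < a by rewrite /a !mulr_gt0 ?exprn_gt0 // hp.
have {}b0 : 0 < b by rewrite /b !mulr_gt0 ?exprn_gt0 // hp.
have ab0 : 0 < a + b by rewrite addr_gt0.
have {}WE : wronsk (glift p i j) t =
    (a + b) *: hom ((1 - b / (a + b)) *: x + (b / (a + b)) *: y).
  rewrite WE; apply: row3P; rewrite !entryE !homE !extE ?entryE; field; lra.
exists x, y, (b / (a + b)); split => //.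
- by rewrite divr_gt0 //= ltr_pdivrMr // mul1r; lra.
- by rewrite WE scaler_eq0 negb_or hom_neq0 gt_eqF.
- by rewrite WE pclassZ ?hom_neq0 ?gt_eqF.
Qed.

Lemma plin_continuous p : continuous (plin p).
Proof.
have dE t : plin p t = cos t *: lin p (\row_k (k == 0)%:R) + sin t *: lin p (\row_k (k == 1)%:R).
  by apply: row3P; rewrite !entryE !linE !mxE /=; ring.
rewrite (funext dE); apply: contD; apply: contZ; [exact: continuous_cos|exact: continuous_sin].
Qed.

Lemma ev_plin_continuous p x : continuous (fun t => ev (plin p t) x).
Proof.
move=> t; apply: (@continuous_comp _ _ _ (plin p) (fun v : 'rV[R]_3 => ev v x)).
  exact: plin_continuous.
exact: ev_continuous.
Qed.

Lemma ev_plinD p x t s : ev (plin p (t + s)) x =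
  cos s * ev (plin p t) x + sin s * det2 (dir' t) (x - p).
Proof.
rewrite /plin !ev_lin !det2E !dirE !dir'E cosD sinD; ring.
Qed.

Lemma vtx_neq_inner p k : inner p -> vtx P k != p.
Proof.
move=> hp; apply/eqP => h; apply: (inner_not_bdry hp).
by rewrite -h -epoint0; apply: bdry_epoint; rewrite lexx ler01.
Qed.

Lemma ev_plin_right p t sg x :
  ev (plin p (t + r * sg)) x @[r --> 0^'+] --> ev (plin p t) x.
Proof.
rewrite -[X in _ --> ev (plin p X) x]addr0 -[X in _ --> ev (plin p (t + X)) x](mul0r sg).
apply: cvg_at_right_filter.
have cl : continuous (fun r : R => t + r * sg).
  by apply: contD; [exact: cont_cst|apply: contM; [move=> ?; exact: cvg_id|exact: cont_cst]].
apply: (@continuous_comp _ _ _ (fun r : R => t + r * sg) (fun t => ev (plin p t) x)).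
  exact: cl.
exact: ev_plin_continuous.
Qed.

(** A line that contains the vertex leaves it at once when it turns, because the
    vertex is not the centre [p]. *)
Lemma vtx_side_near p t sg k : inner p -> sg != 0 ->
  (\forall r \near 0^'+, 0 < ev (plin p (t + r * sg)) (vtx P k)) \/
  (\forall r \near 0^'+, ev (plin p (t + r * sg)) (vtx P k) < 0).
Proof.
move=> hp sg0; set f := fun r => ev (plin p (t + r * sg)) (vtx P k).
have cf : f r @[r --> 0^'+] --> f 0 by rewrite /f mul0r addr0; exact: ev_plin_right.
have f0E : f 0 = ev (plin p t) (vtx P k) by rewrite /f mul0r addr0.
have [fz|fz|fz] := ltgtP (f 0) 0.
- by right; exact: cvgr_lt cf _ fz.
- by left; exact: cvgr_gt cf _ fz.
have fE r : f r = sin (r * sg) * det2 (dir' t) (vtx P k - p).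
  by rewrite /f ev_plinD -f0E fz mulr0 add0r.
have d0 : det2 (dir' t) (vtx P k - p) != 0.
  apply/eqP => d0; have := vtx_neq_inner k hp; rewrite -subr_eq0 => /eqP; apply.
  have h1 : det2 (vtx P k - p) (dir' t) = 0 by rewrite det2C d0 oppr0.
  have h2 : det2 (vtx P k - p) (dir t) = 0.
    by rewrite det2C -ev_lin -/(plin p t) -f0E fz oppr0.
  by apply: det2_basis h1 h2 _; rewrite det2_dir oner_neq0.
have small : \forall r \near 0^'+, 0 < r * `|sg| < pi.
  near=> r; apply/andP; split; first by rewrite mulr_gt0 ?normr_gt0.
  rewrite -ltr_pdivlMr ?normr_gt0 //; near: r; apply: nbhs_right_lt.
  by rewrite divr_gt0 ?pi_gt0 ?normr_gt0.
have sgn r : 0 < r * `|sg| < pi -> 0 < sin (r * `|sg|) by move=> h; exact: sin_gt0_pi.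
have sinE r : sin (r * sg) = Num.sg sg * sin (r * `|sg|).
  rewrite {1}(numEsg sg); case: (sgrP sg) sg0 => // _ _.
    by rewrite !mul1r.
  by rewrite !mulN1r mulrN sinN.
have [h|h|/eqP] := ltgtP (Num.sg sg * det2 (dir' t) (vtx P k - p)) 0.
- right; apply: filterS small => r /sgn hr.
  by rewrite -/(f r) fE sinE mulrAC nmulr_rlt0.
- left; apply: filterS small => r /sgn hr.
  by rewrite -/(f r) fE sinE mulrAC mulr_gt0.
- by rewrite mulf_eq0 sgr_eq0 (negPf sg0) (negPf d0).
Unshelve. all: by end_near. Qed.

Lemma right_filter_ex (A : set R) : (\forall r \near 0^'+, A r) ->
  exists2 e, 0 < e & forall r, 0 < r < e -> A r.
Proof.
move=> /nbhs_ballP[e /= e0 h]; exists e => // r /andP[r0 re]; apply: h => //.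
by rewrite /ball /= sub0r normrN gtr0_norm.
Qed.

(** Just beside any angle no vertex changes sides, and weak inequalities pass to
    the limit; so one pair of sides, hence one lift, serves on a closed arc. *)
Lemma exits_one_sided p t sg : inner p -> sg != 0 -> exists i j e, 0 < e /\
  forall r, 0 <= r <= e -> exits P (plin p (t + r * sg)) i /\
                           exits P (- plin p (t + r * sg)) j.
Proof.
move=> hp sg0; have n1 := half_gt1 hP; have N0 : (0 < n.*2)%N by clear -n1; lia.
pose f k r := ev (plin p (t + r * sg)) (vtx P k).
pose pos k := `[< \forall r \near 0^'+, 0 < f k r >].
have fmod k : f k = f (k %% n.*2)%N.
  by apply/funext => r; rewrite /f (@vtx_mod _ _ P (k %% n.*2) k) // modn_mod.
have near_k k : \forall r \near 0^'+, if pos k then 0 < f k r else f k r < 0.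
  rewrite /pos; case: asboolP => // h.
  by case: (vtx_side_near t k hp sg0).
have : \forall r \near (0 : R)^'+, forall k : 'I_(n.*2), if pos k then 0 < f k r else f k r < 0.
  by apply: (@filter_forall _ _ _ (0^'+)) => k; exact: near_k.
move=> /right_filter_ex[e e0 he].
have {}he k r : 0 < r < e -> if pos k then 0 < f k r else f k r < 0.
  move=> /he/(_ (Ordinal (ltn_pmod k N0))) /=.
  by rewrite /pos (fmod k).
have e2 : 0 < e / 2 < e by apply/andP; split; lra.
have u0 := dir_neq0 (t + e / 2 * sg).
have [i [j [/andP[i0 i1]]]] := exits_pair hP hp u0.
rewrite /exits !evN oppr_ge0 oppr_le0 => /andP[j0 j1].
have pi0 : pos i by have := he i _ e2; case: (pos i) => //; rewrite ltNge /f i0.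
have pi1 : pos i.+1 = false by have := he i.+1 _ e2; case: (pos i.+1) => //; rewrite ltNge /f i1.
have pj0 : pos j = false by have := he j _ e2; case: (pos j) => //; rewrite ltNge /f j0.
have pj1 : pos j.+1 by have := he j.+1 _ e2; case: (pos j.+1) => //; rewrite ltNge /f j1.
have cf k : f k r @[r --> 0^'+] --> f k 0 by rewrite /f mul0r addr0; exact: ev_plin_right.
have h0 k : if pos k then 0 <= f k 0 else f k 0 <= 0.
  have := near_k k; case: (pos k) => h; rewrite leNgt; apply/negP => hn.
    by have [r [h1 h2]] := filter_ex (filterI h (cvgr_lt _ (cf k) _ hn)); lra.
  by have [r [h1 h2]] := filter_ex (filterI h (cvgr_gt _ (cf k) _ hn)); lra.
have main k r : 0 <= r <= e / 2 -> if pos k then 0 <= f k r else f k r <= 0.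
  move=> /andP[]; rewrite le_eqVlt => /orP[/eqP <- _|r0 re]; first exact: h0.
  have := he k r; rewrite r0 (le_lt_trans re) //; last by lra.
  by move=> /(_ isT); case: (pos k) => /ltW.
exists i, j, (e / 2); split; first by lra.
move=> r hr; rewrite !evN oppr_ge0 oppr_le0.
have := main i r hr; have := main i.+1 r hr; have := main j r hr; have := main j.+1 r hr.
by rewrite pi0 pi1 pj0 pj1 /f => -> -> -> ->.
Qed.

End DualOfPencil.

(** * The dual of the image of a pencil *)
Section Subdivision.
Variable R : realType.

(** Real induction: the supremum of the points that can be reached by a chain is
    itself reached, and can be passed unless it is [b]. *)
Lemma subdivision (G : R -> R -> Prop) (a b : R) : a <= b ->
  (forall t, exists2 e, 0 < e & forall r, 0 < r <= e -> G t (t + r) /\ G (t - r) t) ->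
  exists (k : nat) (tau : nat -> R),
    [/\ tau 0%N = a, tau k = b & forall j, (j < k)%N -> G (tau j) (tau j.+1)].
Proof.
move=> ab hG.
pose chain x := exists (k : nat) (tau : nat -> R),
    [/\ tau 0%N = a, tau k = x & forall j, (j < k)%N -> G (tau j) (tau j.+1)].
have chainS x y : chain x -> G x y -> chain y.
  move=> [k [tau [t0 tk ht]]] Gxy.
  exists k.+1, (fun j => if (j <= k)%N then tau j else y); split => //.
    by rewrite ltnn.
  move=> j; rewrite ltnS => jk; rewrite jk; case: ltnP => [jk'|kj]; first exact: ht.
  by have -> : j = k; [lia|rewrite tk].
pose S := [set x | a <= x <= b /\ chain x].
have Sa : S a by split; [rewrite lexx|exists 0%N, (fun=> a)].
have hS : has_sup S by split; [exists a|exists b => x [/andP[]]].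
have ac : a <= sup S by apply: sup_upper_bound.
have cb : sup S <= b by apply: ge_sup; [exists a|move=> x [/andP[]]].
have [e e0 he] := hG (sup S).
have [x [/andP[ax xb] cx] xc] := sup_adherent e0 hS.
have xS : x <= sup S by apply: sup_upper_bound => //; split => //; rewrite ax.
have cc : chain (sup S).
  move: xS; rewrite le_eqVlt => /orP[/eqP <-//|xS].
  apply: chainS cx _; have [|_] := he (sup S - x); first by apply/andP; split; lra.
  by rewrite opprB addrC subrK.
move: cb; rewrite le_eqVlt => /orP[/eqP <-//|cb]; exfalso.
set r := Num.min e (b - sup S).
have r0 : 0 < r by rewrite lt_min e0 subr_gt0.
have [|h _] := he r; first by rewrite r0 ge_min lexx.
suff : sup S + r <= sup S by lra.
apply: sup_upper_bound => //; split; last exact: chainS cc h.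
have : r <= b - sup S by rewrite ge_min lexx orbT.
by move=> rb; apply/andP; split; lra.
Qed.

Lemma segP (x y z : 'rV[R]_2) :
  seg x y z <-> exists2 s, 0 <= s <= 1 & z = (1 - s) *: x + s *: y.
Proof.
split=> [[s]|[s s01 ->]]; first by rewrite /= in_itv /= => s01 <-; exists s.
by exists s; rewrite //= in_itv.
Qed.

Lemma seg_left (x y : 'rV[R]_2) : seg x y x.
Proof. by apply/segP; exists 0; rewrite ?lexx ?ler01 // subr0 scale1r scale0r addr0. Qed.

Lemma seg_right (x y : 'rV[R]_2) : seg x y y.
Proof. by apply/segP; exists 1; rewrite ?lexx ?ler01 // subrr scale1r scale0r add0r. Qed.

Lemma pseg_pt (x y : 'rV[R]_2) u : pseg (pt x) (pt y) u <-> (@pt R @` seg x y) u.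
Proof.
split=> [[->|->|[x' [y' [/pt_inj <- /pt_inj <-]]]]//|h].
- by exists x => //; exact: seg_left.
- by exists y => //; exact: seg_right.
by constructor 3; exists x, y.
Qed.

Lemma seg_self (x y : 'rV[R]_2) : seg x x y -> y = x.
Proof. by move=> [s _ <-]; rewrite -scalerDl subrK scale1r. Qed.

Lemma near_sided (t e sg : R) (A : R -> Prop) : 0 < e ->
  (forall r, 0 <= r <= e -> A (t + r * sg)) -> sg * sg = 1 ->
  \forall s \near within [set s | 0 <= (s - t) * sg] (nbhs t), A s.
Proof.
move=> e0 h sg1; apply/nbhs_ballP; exists e => //= s; rewrite /ball /= => hs h0.
have -> : s = t + ((s - t) * sg) * sg by rewrite -mulrA sg1 mulr1 addrC subrK.
apply: h; rewrite h0 /=; apply/ltW.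
have nsg : `|sg| = 1.
  apply/eqP; rewrite -(@eqrXn2 _ 2%N) // ?expr1n.
  by rewrite -normrX expr2 sg1 normr1.
by rewrite (le_lt_trans (ler_norm _)) // normrM nsg mulr1 distrC.
Qed.

Lemma half_line_le (t : R) : [set s | s <= t] = [set s | 0 <= (s - t) * -1].
Proof. by apply/seteqP; split=> s /=; rewrite mulrN1 opprB subr_ge0. Qed.

Lemma half_line_ge (t : R) : [set s | t <= s] = [set s | 0 <= (s - t) * 1].
Proof. by apply/seteqP; split=> s /=; rewrite mulr1 subr_ge0. Qed.

End Subdivision.

Section ArtInPolygon.
Variables (R : realType) (n : nat).
Variable P : (n.*2).-tuple 'rV[R]_2.
Hypothesis hP : cppos P.
Implicit Types (i j k : nat) (p x y z u o : 'rV[R]_2) (v w : 'rV[R]_3).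
Implicit Types (s t : R).
Local Notation side := (side P).
Local Notation epoint := (epoint P).
Local Notation inner := (inner P).
Local Notation transverse := (transverse P).

Lemma plinN p t : plin p (t + pi) = - plin p t.
Proof. by apply: row3P; rewrite entryE /plin !linE !dirE ?cosDpi ?sinDpi; ring. Qed.

Lemma pencil_periodic p t : pencil p (t + pi) = pencil p t.
Proof.
rewrite !pencilE plinN -scaleN1r pclassZ ?oppr_eq0 ?oner_eq0 //.
by rewrite lin_neq0 // dir_neq0.
Qed.

Lemma smooth_glift p i j : smooth (glift P p i j).
Proof. by rewrite glift_quad; exact: (smooth_quad _).1. Qed.

Lemma Gamma_piecewise p : inner p -> piecewise_smooth_closed (Gamma P p) pi.
Proof.
move=> hp; split; [exact: pi_gt0|by move=> t; rewrite /Gamma pencil_periodic|].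
pose G a b := a < b /\ exists2 L, smooth L & forall s, a <= s <= b ->
  lifts (Gamma P p) L s /\ wronsk L s != 0.
apply: (@subdivision R G); first exact: pi_ge0.
have arc t sg : sg * sg = 1 -> exists e, 0 < e /\ exists2 L, smooth L &
    forall r, 0 <= r <= e -> lifts (Gamma P p) L (t + r * sg) /\ wronsk L (t + r * sg) != 0.
  move=> sg1; have sg0 : sg != 0.
    by apply/eqP => h; move/eqP: sg1; rewrite h mul0r eq_sym oner_eq0.
  have [i [j [e [e0 he]]]] := exits_one_sided hP t hp sg0.
  exists e; split => //; exists (glift P p i j); first exact: smooth_glift.
  move=> r /he[ei ej]; split; first exact: Gamma_exits.
  by have [? [? [? []]]] := wronsk_exits hP hp ei ej.
move=> t; have [e [e0 [L sL hL]]] := arc t 1 (mulr1 1).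
have [e' [e'0 [L' sL' hL']]] := arc t (-1) (etrans (mulrNN 1 1) (mulr1 1)).
exists (Num.min e e'); first by rewrite lt_min e0.
move=> r /andP[r0]; rewrite le_min => /andP[re re']; split.
  split; first by lra.
  exists L => // s /andP[ts st].
  have -> : s = t + (s - t) * 1 by ring.
  by apply: hL; apply/andP; split; lra.
split; first by lra.
exists L' => // s /andP[ts st].
have -> : s = t + (t - s) * -1 by ring.
by apply: hL'; apply/andP; split; lra.
Qed.

Lemma region_convex x y c : region P x -> region P y -> 0 < c < 1 ->
  region P ((1 - c) *: x + c *: y).
Proof. by move=> rx ry /andP[c0 c1]; apply: region_comb => //; rewrite !ltW. Qed.

Lemma one_sided_envelope_region p t sg q : inner p -> sg * sg = 1 ->
  envelope (Gamma P p) [set s | 0 <= (s - t) * sg] t q ->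
  exists2 x, region P x & q = pt x.
Proof.
move=> hp sg1 hq; have sg0 : sg != 0.
  by apply/eqP => h; move/eqP: sg1; rewrite h mul0r eq_sym oner_eq0.
have [i [j [e [e0 he]]]] := exits_one_sided hP t hp sg0.
have [|ei ej] := he 0; first by rewrite lexx ltW.
rewrite mul0r addr0 in ei ej.
have [x [y [c [bx by_ c01 w0 wE]]]] := wronsk_exits hP hp ei ej.
exists ((1 - c) *: x + c *: y); first by apply: region_convex => //; exact: bdry_region.
rewrite -wE; apply: envelope_eq hq _ _ w0.
- exists sg => // r r0 /=; rewrite addrC addKr.
  by rewrite -mulrA sg1 mulr1.
- by apply: smooth_derivable; exact: smooth_glift.
- by apply: near_sided e0 _ sg1 => r /he[ei' ej']; exact: Gamma_exits.
Qed.

(** Both one-sided envelope points are in the convex set [P], and so is the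
    segment between them. *)
Lemma ART_sub p : inner p -> ART P p `<=` @pt R @` region P.
Proof.
move=> hp u [t [q [r []]]]; rewrite half_line_le half_line_ge => hq hr.
have [x rx ->] := one_sided_envelope_region hp (etrans (mulrNN 1 1) (mulr1 1)) hq.
have [y ry ->] := one_sided_envelope_region hp (mulr1 1) hr.
move=> /pseg_pt[z /segP[s s01 ->] <-].
by exists ((1 - s) *: x + s *: y) => //; exact: region_comb.
Qed.

Section CentralSymmetry.
Variable o : 'rV[R]_2.
Hypothesis ho : forall x, region P x -> region P (2 *: o - x).

(** The reflection carries the face of [P] on the line of a side onto the face
    where the parallel support line touches, which is the opposite side. *)
Lemma central_side i : exists2 r : R, 0 < r & exists a b : R, [/\ 0 <= a <= 1,
  0 <= b <= 1, 2 *: o - vtx P i = epoint (i + n) a, edge P (i + n) = - r *: edge P i &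
  (b - a) * r = 1].
Proof.
have [r r0 er] := edge_opp hP i.
have oppE x : side (i + n) x = r * (side i (vtx P (i + n)) - side i x).
  by rewrite !sideE er !det2E !mxE; ring.
have top x : region P x -> side i x <= side i (vtx P (i + n)).
  by move=> /(region_side hP (i + n)); rewrite oppE pmulr_rge0 // subr_ge0.
have Q0 : side i (2 *: o - vtx P i) = side i (vtx P (i + n)).
  apply/le_anti/andP; split; first by apply: top; apply: ho; exact: region_vtx.
  have := region_side hP i (ho (@region_vtx _ _ P (i + n))).
  by rewrite !sideE !det2E !mxE; lra.
have Q1 : side i (2 *: o - vtx P i.+1) = side i (vtx P (i + n)).
  by rewrite -Q0 vtxS !sideE !det2E !mxE; ring.
have onface k : side i (2 *: o - vtx P k) = side i (vtx P (i + n)) ->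
    exists2 s, 0 <= s <= 1 & 2 *: o - vtx P k = epoint (i + n) s.
  move=> h; apply: (side_eq0 hP); last by rewrite oppE h subrr mulr0.
  by move=> m; apply: region_side => //; apply: ho; exact: region_vtx.
have [a a01 ha] := onface i Q0; have [b b01 hb] := onface i.+1 Q1.
exists r => //; exists a, b; split => //.
have : epoint (i + n) a - epoint (i + n) b = edge P i.
  by rewrite -ha -hb vtxS; apply: row2P; rewrite !mxE; ring.
rewrite ?epointDE er opprD addrACA subrr add0r -scalerBl scalerA => /eqP.
rewrite -[X in _ == X]scale1r -subr_eq0 -scalerBl scaler_eq0.
by rewrite (negPf (edge_neq0 hP i)) orbF subr_eq0 => /eqP; lra.
Qed.

Lemma central_vtx i : vtx P (i + n) = 2 *: o - vtx P i.
Proof.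
have [r r0 [a [b [/andP[a0 a1] /andP[b0 b1] h er ab]]]] := central_side i.
have [r' r'0 [a' [b' [/andP[a'0 a'1] /andP[b'0 b'1] _ er' ab']]]] := central_side (i + n).
rewrite edgeDD er scalerA in er'.
have /eqP : (1 - r' * r) *: edge P i = 0.
  by rewrite scalerBl scale1r {1}er' mulrNN subrr.
rewrite scaler_eq0 (negPf (edge_neq0 hP i)) orbF subr_eq0 => /eqP rr.
(* The two factors are inverse to each other and both at least [1], because a
   side has parameters in [0, 1] only; so they are [1] and [a = 0]. *)
have le1 (c d q : R) : 0 < q -> 0 <= c -> d <= 1 -> (d - c) * q = 1 -> 1 <= q.
  by move=> q0 c0 d1 <-; rewrite ler_piMl ?(ltW q0) //; lra.
have r1 : 1 <= r := le1 _ _ _ r0 a0 b1 ab.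
have r'1 : 1 <= r' := le1 _ _ _ r'0 a'0 b'1 ab'.
have r2 : r = 1 by apply/le_anti; rewrite r1 andbT rr ler_peMl // ltW.
have a00 : a = 0 by move: ab; rewrite r2 mulr1; lra.
by rewrite h a00 epoint0.
Qed.

Lemma central_epoint i s : epoint (i + n) s = 2 *: o - epoint i s.
Proof.
by rewrite !epointE -addSn !central_vtx; apply: row2P; rewrite !mxE; ring.
Qed.

Lemma central_sigma x : bdry P x -> sigma P x = 2 *: o - x.
Proof.
by move=> [i [s [s01 ->]]]; rewrite (sigma_epoint hP) // central_epoint.
Qed.

Lemma central_Gamma p t : inner p -> Gamma P p t = pclass (plin (2 *: o - p) t).
Proof.
move=> hp; rewrite /Gamma pencilE.
have u0 := dir_neq0 t.
have [x [y [bx by_ T E _]]] := inner_chord hP hp u0.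
have xy := transverse_neq bx T.
rewrite /plin E (Phi_join hP) // !central_sigma //; apply/esym/join_on.
- by move=> /addrI/oppr_inj.
- apply/on_lin => //; have : on (pclass (lin p (dir t))) x.
    by rewrite E; apply/on_join => //; rewrite subrr det2r0.
  by move=> /(on_lin _ _ u0); rewrite !det2E !mxE; lra.
- apply/on_lin => //; have : on (pclass (lin p (dir t))) y.
    by rewrite E; apply/on_join => //; rewrite det2vv.
  by move=> /(on_lin _ _ u0); rewrite !det2E !mxE; lra.
Qed.

Definition pencil_coeff q : 'rV[R]_3 * 'rV[R]_3 :=
  (lin q (\row_k (k == 0)%:R), lin q (\row_k (k == 1)%:R)).

Lemma plin_trig q : plin q = trig_curve (pencil_coeff q).
Proof.
apply/funext => t.
by apply: row3P; rewrite /trig_curve !entryE !linE !mxE /=; ring.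
Qed.

Lemma wronsk_plin q t : wronsk (plin q) t = hom q.
Proof.
rewrite plin_trig wronsk_trig; apply: row3P;
  by rewrite crossE !linE homE !extE !mxE /=; ring.
Qed.

Lemma central_ART p : inner p -> ART P p = [set pt (2 *: o - p)].
Proof.
move=> hp; set q := 2 *: o - p.
have sq : smooth (plin q) by rewrite plin_trig; exact: (smooth_trig _).1.
have lq s : lifts (Gamma P p) (plin q) s.
  by split; [rewrite lin_neq0 ?dir_neq0|exact: central_Gamma].
have w0 s : wronsk (plin q) s != 0 by rewrite wronsk_plin hom_neq0.
have lD D s : \forall s \near within D (nbhs s), lifts (Gamma P p) (plin q) s.
  by apply: nearW => s'; exact: lq.
have env D s r : one_sided D s -> envelope (Gamma P p) D s r -> r = pt q.
  move=> oD hr; rewrite (envelope_eq oD hr _ (lD D s) (w0 s)) ?wronsk_plin //.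
  exact: smooth_derivable.
apply/seteqP; split=> [u [t [r [r' [h h']]]]|_ ->].
  rewrite (env _ _ _ (one_sided_le t) h) (env _ _ _ (one_sided_ge t) h').
  by move=> /pseg_pt[z /seg_self -> <-].
have ex D : envelope (Gamma P p) D 0 (pt q).
  by rewrite /pt -(wronsk_plin q 0); exact: envelope_lift.
by exists 0, (pt q), (pt q); split => //; constructor 1.
Qed.

End CentralSymmetry.

End ArtInPolygon.

(** * Fixed lines *)
Section FixedLines.
Variables (R : realType) (n : nat).
Variable P : (n.*2).-tuple 'rV[R]_2.
Hypothesis hP : cppos P.
Implicit Types (i j k : nat) (p x y z u : 'rV[R]_2) (v w : 'rV[R]_3).
Implicit Types (s t : R) (m : int).
Local Notation side := (side P).
Local Notation epoint := (epoint P).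
Local Notation inner := (inner P).
Local Notation transverse := (transverse P).

(** If the chord is fixed, then [sigma] exchanges its end points: it has no fixed
    point, since [x] and [sigma x] are never on a common side. *)
Lemma fixed_lines : [set l | band P l /\ Phi P l = l] =
  [set join x (sigma P x) | x in bdry P].
Proof.
apply/seteqP; split=> [l [/(band_chord hP)[x [y [bx by_ T ->]]]]|_ [x bx <-]].
  rewrite (Phi_join hP bx by_ T) => h; exists x; first exact: bx.
  have bsx := bdry_sigma hP bx; have bsy := bdry_sigma hP by_.
  have := join_bdry hP bx by_ T.
  rewrite -h (join_bdry hP bsx bsy (transverse_sigma hP bx by_ T)).
  move=> /(@set2_eq _ _ _ _ _)[[sx _]|[sy _]]; last by rewrite h sy.
  by case: (transverse_neq bx (transverse_self hP bx)).
have bsx := bdry_sigma hP bx; have T := transverse_self hP bx.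
split; first by apply/(band_chord hP); exists x, (sigma P x).
by rewrite (Phi_join hP) // (sigmaK hP) // join_sym.
Qed.

Lemma Dpt_mod i j : i = j %[mod n.*2] -> Dpt P i = Dpt P j.
Proof.
move=> h; rewrite /Dpt /Defs.diagonal (vtx_mod P h) (vtx_mod P (modnD_eq n h)).
by rewrite (vtx_mod P (modnS_eq h)) (vtx_mod P (modnD_eq n (modnS_eq h))).
Qed.

Lemma diagonal_neq i : vtx P i <> vtx P (i + n).
Proof.
by move=> h; have := side_opp_gt0 hP i; rewrite -h -epoint0 side_epoint_self ltxx.
Qed.

(** The homothety taking a side to the opposite one has the crossing point of
    the two great diagonals as its centre. *)
Lemma DptE i : exists2 r : R, 0 < r & edge P (i + n) = - r *: edge P i /\
  Dpt P i = (1 + r)^-1 *: (r *: vtx P i + vtx P (i + n)).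
Proof.
have [r r0 er] := edge_opp hP i; exists r => //; split => //.
have r1 : 1 + r != 0 by rewrite gt_eqF // addr_gt0.
set e := edge P i in er *; set a := vtx P i; set b := vtx P (i + n).
have h0 : 0 < det2 e (b - a) by exact: side_opp_gt0.
have a1 : vtx P i.+1 = a + e by rewrite vtxS.
have b1 : vtx P (i.+1 + n) = b + - r *: e by rewrite addSn vtxS er.
have onD k z : on (Defs.diagonal P k) z <-> det2 (vtx P (k + n) - vtx P k) (z - vtx P k) = 0.
  by apply: on_join; exact: diagonal_neq.
set D := (1 + r)^-1 *: _.
have D0 : D - a = (1 + r)^-1 *: (b - a).
  by rewrite /D; apply: row2P; rewrite !mxE; field.
have D1 : D - (a + e) = (1 + r)^-1 *: (b + - r *: e - (a + e)).
  by rewrite /D; apply: row2P; rewrite !mxE; field.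
apply: xget_unique => [|z [/onD hz0 /onD hz1]].
  by split; apply/onD; rewrite ?a1 ?b1 -/a -/b ?D0 ?D1 det2Zr det2vv mulr0.
rewrite a1 b1 -/a -/b in hz0 hz1.
apply/eqP; rewrite -subr_eq0; apply/eqP.
apply: (det2_basis (x := b - a) (y := b + - r *: e - (a + e))).
- rewrite (_ : z - D = z - a - (D - a)); last by rewrite opprB addrA subrK.
  by rewrite det2C det2Br hz0 D0 det2Zr det2vv mulr0 subrr oppr0.
- rewrite (_ : z - D = z - (a + e) - (D - (a + e))); last by rewrite opprB addrA subrK.
  by rewrite det2C det2Br hz1 D1 det2Zr det2vv mulr0 subrr oppr0.
rewrite (_ : det2 _ _ = - ((1 + r) * det2 e (b - a))).
  by rewrite oppr_eq0 mulf_neq0 // gt_eqF.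
by rewrite !det2E !mxE; ring.
Qed.

Lemma Dpt_side i : 0 < side i (Dpt P i).
Proof.
have [r r0 [er ->]] := DptE i.
have r1 : 0 < 1 + r by rewrite addr_gt0.
rewrite (_ : side i _ = (1 + r)^-1 * side i (vtx P (i + n))).
  by rewrite mulr_gt0 ?invr_gt0 // side_opp_gt0.
by rewrite !sideE !det2E !mxE; field; rewrite gt_eqF.
Qed.

(** Coefficients of the line through [Dpt P i] and the boundary point at parameter
    [t - c] on the [i]-th side, as a function of [t]. *)
Definition fixed_pair i (c : R) : 'rV[R]_3 * 'rV[R]_3 :=
  (cross (hom (Dpt P i)) (hom (vtx P i) - c *: ext (edge P i) 0),
   cross (hom (Dpt P i)) (ext (edge P i) 0)).

Lemma fixed_pairE i c t :
  aff_curve (fixed_pair i c) t = cross (hom (Dpt P i)) (hom (epoint i (t - c))).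
Proof.
rewrite /aff_curve /fixed_pair ?epointDE.
by apply: row3P; rewrite /= !(crossE, entryE) !homE !extE ?entryE; ring.
Qed.

Lemma wronsk_fixed i c t :
  wronsk (aff_curve (fixed_pair i c)) t = side i (Dpt P i) *: hom (Dpt P i).
Proof.
rewrite wronsk_aff /fixed_pair !sideE det2E /=.
apply: row3P; rewrite !(crossE, entryE) !homE !extE ?entryE; ring.
Qed.

Lemma fixed_join i s : 0 <= s <= 1 ->
  cross (hom (Dpt P i)) (hom (epoint i s)) != 0 /\
  join (epoint i s) (sigma P (epoint i s)) =
  pclass (cross (hom (Dpt P i)) (hom (epoint i s))).
Proof.
move=> s01; have [r r0 [er DE]] := DptE i.
have r1 : 0 < 1 + r by rewrite addr_gt0.
have n0 : cross (hom (Dpt P i)) (hom (epoint i s)) != 0.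
  rewrite cross_hom lin_neq0 // subr_eq0; apply/eqP => h.
  by have := Dpt_side i; rewrite -h side_epoint_self ltxx.
split; first exact: n0.
rewrite (sigma_epoint hP i s01) /join.
have -> : cross (hom (epoint i s)) (hom (epoint (i + n) s)) =
    (- (1 + r)) *: cross (hom (Dpt P i)) (hom (epoint i s)).
  rewrite DE ?epointDE er.
  by apply: row3P; rewrite !(crossE, entryE) !homE !extE ?entryE; field; rewrite gt_eqF.
by apply: pclassZ n0; rewrite oppr_eq0 gt_eqF.
Qed.

Definition idx m : nat := `|(m %% (n.*2)%:Z)%Z|%N.

Lemma idxE m : (idx m)%:Z = (m %% (n.*2)%:Z)%Z.
Proof.
have n1 := half_gt1 hP.
by rewrite /idx gez0_abs // modz_ge0 //; clear -n1; lia.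
Qed.

Lemma idx_nat j : idx j%:Z = j %[mod n.*2].
Proof. by rewrite /idx modz_nat absz_nat modn_mod. Qed.

Lemma idxS m : idx (m + 1) = (idx m).+1 %[mod n.*2].
Proof.
suff : ((idx (m + 1))%:Z %% (n.*2)%:Z)%Z = ((idx m).+1%:Z %% (n.*2)%:Z)%Z.
  by rewrite !modz_nat => -[].
by rewrite idxE modz_mod -addn1 PoszD idxE modzDml.
Qed.

Lemma idx_period m : idx (m + (n.*2)%:Z) = idx m.
Proof. by rewrite /idx modzDr. Qed.

Lemma bdry_paramE m t : m%:~R <= t <= (m + 1)%:~R ->
  bdry_param P t = epoint (idx m) (t - m%:~R).
Proof.
move=> /andP[mt]; rewrite le_eqVlt => /orP[/eqP ->|tm].
  have -> : ((m + 1)%:~R - m%:~R : R) = 1 by rewrite intrD addrC addKr.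
  rewrite epoint1 /bdry_param intrKfloor -/(idx (m + 1)) subrr scale0r addr0.
  exact/vtx_mod/idxS.
have fl : Num.floor t = m by apply: floor_def; rewrite mt.
by rewrite /bdry_param fl.
Qed.

Lemma lifts_fixed m t : m%:~R <= t <= (m + 1)%:~R ->
  lifts (fixed_curve P) (aff_curve (fixed_pair (idx m) m%:~R)) t.
Proof.
move=> mt; rewrite /lifts /fixed_curve (bdry_paramE mt) fixed_pairE.
apply: fixed_join; move: mt; rewrite intrD => /andP[h1 h2].
by apply/andP; split; lra.
Qed.

Lemma wronsk_fixed_neq0 i c t : wronsk (aff_curve (fixed_pair i c)) t != 0.
Proof.
by rewrite wronsk_fixed scaler_eq0 negb_or hom_neq0 gt_eqF // Dpt_side.
Qed.

Lemma pclass_wronsk_fixed i c t :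
  pclass (wronsk (aff_curve (fixed_pair i c)) t) = pt (Dpt P i).
Proof.
by rewrite wronsk_fixed pclassZ ?hom_neq0 // gt_eqF // Dpt_side.
Qed.

Lemma fixed_periodic t : fixed_curve P (t + (n.*2)%:R) = fixed_curve P t.
Proof.
have /andP[f1 /ltW f2] := floor_itv t; set m := Num.floor t in f1 f2.
have mt : m%:~R <= t <= (m + 1)%:~R by rewrite f1.
have e : ((m + (n.*2)%:Z)%:~R : R) = m%:~R + (n.*2)%:R by rewrite intrD.
have mt' : (m + (n.*2)%:Z)%:~R <= t + (n.*2)%:R <= (m + (n.*2)%:Z + 1)%:~R.
  rewrite [X in _ <= _ <= X]intrD e; move: f2; rewrite intrD => f2.
  by apply/andP; split; lra.
suff E : bdry_param P (t + (n.*2)%:R) = bdry_param P t by rewrite /fixed_curve E.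
by rewrite (bdry_paramE mt) (bdry_paramE mt') idx_period e opprD addrACA subrr addr0.
Qed.

Lemma fixed_piecewise : piecewise_smooth_closed (fixed_curve P) (n.*2)%:R.
Proof.
have n1 := half_gt1 hP; split.
- by rewrite ltr0n; clear -n1; lia.
- exact: fixed_periodic.
exists n.*2, (fun j => j%:R); split => // j _; split; first by rewrite ltr_nat.
exists (aff_curve (fixed_pair (idx j%:Z) (j%:Z)%:~R)); first exact: (smooth_aff _).1.
move=> s hs; split; last exact: wronsk_fixed_neq0.
by apply: lifts_fixed; rewrite -(PoszD j 1) addn1.
Qed.

Lemma envelope_fixed D m t q : one_sided D t ->
  (\forall s \near within D (nbhs t), m%:~R <= s <= (m + 1)%:~R) ->
  envelope (fixed_curve P) D t q <-> q = pt (Dpt P (idx m)).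
Proof.
move=> oD hD; set L := aff_curve (fixed_pair (idx m) m%:~R).
have lD : \forall s \near within D (nbhs t), lifts (fixed_curve P) L s.
  by apply: filterS hD => s; exact: lifts_fixed.
rewrite -(pclass_wronsk_fixed _ m%:~R t) -/L; split=> [h|->].
  apply: (envelope_eq oD h _ lD); last exact: wronsk_fixed_neq0.
  by apply: smooth_derivable; exact: (smooth_aff _).1.
by apply: envelope_lift => //; [exact: (smooth_aff _).1|exact: wronsk_fixed_neq0].
Qed.

Lemma right_envelope_fixed m t q : m%:~R <= t < (m + 1)%:~R ->
  envelope (fixed_curve P) [set s | t <= s] t q <-> q = pt (Dpt P (idx m)).
Proof.
move=> /andP[mt tm]; apply: envelope_fixed; first exact: one_sided_ge.
have : \forall s \near t, s < (m + 1)%:~R by exact: lt_nbhsl.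
by apply: filterS => s sm /= ts; rewrite (le_trans mt ts) ltW.
Qed.

Lemma left_envelope_fixed m t q : m%:~R < t <= (m + 1)%:~R ->
  envelope (fixed_curve P) [set s | s <= t] t q <-> q = pt (Dpt P (idx m)).
Proof.
move=> /andP[mt tm]; apply: envelope_fixed; first exact: one_sided_le.
have : \forall s \near t, m%:~R < s by exact: lt_nbhsr.
by apply: filterS => s sm /= ts; rewrite ltW //= (le_trans ts tm).
Qed.

Lemma dual_fixed : completed_dual (fixed_curve P) = @pt R @` CSS P.
Proof.
apply/seteqP; split=> [u [t [q [r [hq hr hu]]]]|u [x [i hx] <-]].
  have /andP[f1 f2] := floor_itv t; set m := Num.floor t in f1 f2.
  have rE : r = pt (Dpt P (idx m)) by apply/(right_envelope_fixed _ _).1: hr; rewrite f1.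
  move: f1; rewrite le_eqVlt => /orP[/eqP mt|mt].
    have e : ((m - 1 + 1)%:~R : R) = t by rewrite subrK.
    have qE : q = pt (Dpt P (idx (m - 1))).
      apply/(left_envelope_fixed _ _).1: hq; rewrite e lexx andbT -mt ltr_int.
      by rewrite gtrBl.
    move: hu; rewrite qE rE => /pseg_pt[x hx <-]; exists x => //; exists (idx (m - 1)).
    by rewrite -(Dpt_mod (idxS (m - 1))) subrK.
  have qE : q = pt (Dpt P (idx m)).
    by apply/(left_envelope_fixed _ _).1: hq; rewrite mt ltW.
  move: hu; rewrite qE rE => /pseg_pt[x /seg_self -> <-].
  by exists (Dpt P (idx m)) => //; exists (idx m); exact: seg_left.
have e : ((i%:Z + 1)%:~R : R) = i.+1%:R by rewrite -(PoszD i 1) addn1.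
exists i.+1%:R, (pt (Dpt P i)), (pt (Dpt P i.+1)); split.
- apply/(@left_envelope_fixed i%:Z); first by rewrite e lexx andbT ltr_nat.
  by rewrite (Dpt_mod (idx_nat i)).
- apply/(@right_envelope_fixed i.+1%:Z); last by rewrite (Dpt_mod (idx_nat i.+1)).
  by rewrite lexx /= intrD ltrDl.
by apply/pseg_pt; exists x.
Qed.

End FixedLines.

(** * Conics and cells *)
Section Conics.
Variable R : realType.
Implicit Types (v w m : 'rV[R]_3) (A : 'M[R]_3) (t : R)
  (Q : 'rV[R]_3 * 'rV[R]_3 * 'rV[R]_3).

Lemma conic_pclass A m : m != 0 -> m *m A *m m^T = 0 -> conic A (pclass m).
Proof.
move=> m0 h; rewrite /conic /=; have [c _ ->] := hcoord_pclass m0.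
by rewrite linearZ /= -!scalemxAl -scalemxAr h !scaler0.
Qed.

(** The symmetric matrix of the double line with equation [v]. *)
Lemma rank1_degenerate v : v != 0 ->
  [/\ (v^T *m v)^T = v^T *m v, v^T *m v != 0 & v^T *m v \notin unitmx].
Proof.
move=> v0; split.
- by rewrite trmx_mul trmxK.
- have [k vk] : exists k, v 0 k != 0.
    by move: v0; rewrite row3_neq0 => /or3P[] h; [exists 0|exists 1|exists 2].
  apply/eqP => /matrixP/(_ k k); rewrite !mxE big_ord1 !mxE => /eqP.
  by rewrite mulf_eq0 (negPf vk).
- rewrite -row_free_unit /row_free; apply/eqP => h.
  have := leq_trans (mxrankM_maxr v^T v) (rank_leq_row v).
  by rewrite h.
Qed.

Lemma on_double_line v m : m *m v^T = 0 -> m *m (v^T *m v) *m m^T = 0.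
Proof. by move=> h; rewrite mulmxA h mul0mx mul0mx. Qed.

Lemma ex_orthogonal m : exists2 v : 'rV[R]_3, v != 0 & m *m v^T = 0.
Proof.
have [h|h] := eqVneq (m 0 0) 0.
  exists (ext (\row_k (k == 0)%:R) 0).
    by rewrite row3_neq0 !extE mxE oner_eq0.
  by rewrite dotE /dot !extE !mxE h /= !mulr0 mul0r !addr0 raddf0.
exists (ext (\row_k (if k == 0 then - m 0 1 else m 0 0)) 0).
  by rewrite row3_neq0 !extE !mxE /= h orbT.
rewrite dotE /dot !extE !mxE /= mulr0 addr0 mulrN (mulrC (m 0 1)) addNr.
by rewrite raddf0.
Qed.

(** The parametrization of the conic [y^2 = x z] by monomials of degree two in
    cosine and sine; every [quad_curve] is a linear image of it. *)
Definition veronese t : 'rV[R]_3 :=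
  ext (\row_(k < 2) (if k == 0 then cos t ^+ 2 else cos t * sin t)) (sin t ^+ 2).

Definition coeff_mx Q : 'M[R]_3 :=
  \matrix_(i < 3) (if i == 0 then Q.1.1 else if i == 1 then Q.1.2 else Q.2).

Lemma quad_curveE Q t : quad_curve Q t = veronese t *m coeff_mx Q.
Proof.
apply/rowP => k; rewrite [RHS]mxE !big_ord_recl big_ord0 /quad_curve !entryE.
rewrite (_ : lift ord0 ord0 = 1 :> 'I_3); last exact: val_inj.
rewrite (_ : lift ord0 (lift ord0 ord0) = 2 :> 'I_3); last exact: val_inj.
rewrite /veronese !extE !mxE /=; ring.
Qed.

(** The matrix of [2 (y^2 - x z)]. *)
Definition model_conic : 'M[R]_3 :=
  \matrix_(i < 3) (if i == 0 then ext 0 (-1) else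
    if i == 1 then ext (\row_k (if k == 0 then 0 else 2)) 0
    else ext (\row_k (if k == 0 then -1 else 0)) 0).

Lemma mul_model_conic v : v *m model_conic =
  ext (\row_k (if k == 0 then - v 0 2 else 2 * v 0 1)) (- v 0 0).
Proof.
have e k : (v *m model_conic) 0 k =
    v 0 0 * model_conic 0 k + v 0 1 * model_conic 1 k + v 0 2 * model_conic 2 k.
  rewrite mxE !big_ord_recl big_ord0.
  rewrite (_ : lift ord0 ord0 = 1 :> 'I_3); last exact: val_inj.
  rewrite (_ : lift ord0 (lift ord0 ord0) = 2 :> 'I_3); last exact: val_inj.
  by rewrite addr0 addrA.
have mE i k : model_conic i k = (if i == 0 then ext 0 (-1) else
    if i == 1 then ext (\row_k (if k == 0 then 0 else 2)) 0
    else ext (\row_k (if k == 0 then -1 else 0)) 0) 0 k by rewrite mxE.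
by apply: row3P; rewrite e !mE /= !extE ?mxE /=; ring.
Qed.

Lemma model_conic_sym : model_conic^T = model_conic.
Proof.
apply/matrixP => i j; rewrite [LHS]mxE.
have ee (a b : 'I_3) : model_conic a b = (delta_mx 0 a *m model_conic : 'rV[R]_3) 0 b.
  by rewrite -rowE [RHS]mxE.
rewrite !ee !mul_model_conic.
have I3 (a : 'I_3) : [\/ a = 0, a = 1 | a = 2].
  case: a => [[|[|[|a]]] ha] //; [constructor 1|constructor 2|constructor 3]; exact: val_inj.
by case: (I3 i) => ->; case: (I3 j) => ->; rewrite !extE !mxE /= ?mulr0 ?oppr0.
Qed.

Lemma model_conic_unit : model_conic \in unitmx.
Proof.
rewrite unitmxE unitfE; apply/det0P => -[v v0].
rewrite mul_model_conic => /rowP h; move: v0; rewrite row3_neq0.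
have := h 0; have := h 1; have := h 2; rewrite !extE !mxE /=.
move=> /eqP + /eqP + /eqP; rewrite !oppr_eq0 mulf_eq0 pnatr_eq0 /=.
by move=> -> -> ->.
Qed.

Lemma veronese_conic t : veronese t *m model_conic *m (veronese t)^T = 0.
Proof.
rewrite mul_model_conic dotE /dot /veronese !extE !mxE /=.
by rewrite (_ : _ + _ = 0) ?raddf0 //; ring.
Qed.

Lemma quad_curve_conic Q t : coeff_mx Q \in unitmx ->
  let K := invmx (coeff_mx Q) in
  quad_curve Q t *m (K *m model_conic *m K^T) *m (quad_curve Q t)^T = 0.
Proof.
move=> u K; rewrite quad_curveE trmx_mul !mulmxA mulmxK // -!mulmxA.
rewrite (mulmxA K^T) -trmx_mul mulmxV // trmx1 mul1mx mulmxA.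
exact: veronese_conic.
Qed.

Definition veronese' t : 'rV[R]_3 :=
  ext (\row_(k < 2) (if k == 0 then - (2 * (cos t * sin t)) else cos t ^+ 2 - sin t ^+ 2))
    (2 * (cos t * sin t)).

Lemma derive_quad_curveE Q t : derive1 (quad_curve Q) t = veronese' t *m coeff_mx Q.
Proof.
rewrite (smooth_quad _).2; apply/rowP => k; rewrite [RHS]mxE !big_ord_recl big_ord0.
rewrite (_ : lift ord0 ord0 = 1 :> 'I_3); last exact: val_inj.
rewrite (_ : lift ord0 (lift ord0 ord0) = 2 :> 'I_3); last exact: val_inj.
rewrite /quad_curve !entryE /veronese' !extE !mxE /=; ring.
Qed.

Lemma cross_veronese_neq0 t : cross (veronese t) (veronese' t) != 0.
Proof.
rewrite row3_neq0 !crossE /veronese /veronese' !extE !mxE /=.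
have cs := cos2Dsin2 t; set c := cos t in cs *; set s := sin t in cs *.
have e0 : c * s * (2 * (c * s)) - s ^+ 2 * (c ^+ 2 - s ^+ 2) = s ^+ 2 * (c ^+ 2 + s ^+ 2).
  by ring.
have e2 : c ^+ 2 * (c ^+ 2 - s ^+ 2) - c * s * - (2 * (c * s)) = c ^+ 2 * (c ^+ 2 + s ^+ 2).
  by ring.
rewrite e0 e2 cs !mulr1 orbCA; apply/orP; right; rewrite -negb_and.
by apply/negP => /andP[/eqP s0 /eqP c0]; move/eqP: cs; rewrite s0 c0 addr0 eq_sym oner_eq0.
Qed.

(** Independence of the coefficients makes the curve regular, as the model is:
    its velocity is never proportional to its position vector. *)
Lemma quad_curve_regular Q t : coeff_mx Q \in unitmx -> wronsk (quad_curve Q) t != 0.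
Proof.
move=> u; apply/eqP; rewrite /wronsk derive_quad_curveE quad_curveE => h.
have nz v : v != 0 -> v *m coeff_mx Q != 0.
  by apply: contraNneq => v0; rewrite -(mulmxK u v) v0 mul0mx.
have ver0 : veronese t != 0.
  by apply: contraNneq (cross_veronese_neq0 t) => ->; rewrite cross0v.
have ver'0 : veronese' t != 0.
  by apply: contraNneq (cross_veronese_neq0 t) => ->; rewrite crossC cross0v oppr0.
have [c _ vE] := cross_eq0 (nz _ ver0) (nz _ ver'0) h.
have {}vE : veronese t = c *: veronese' t.
  by rewrite -(mulmxK u (veronese t)) vE scalemxAl mulmxK.
by have := cross_veronese_neq0 t; rewrite vE crossZl crossvv scaler0 eqxx.
Qed.

(** A vector in the kernel of the coefficient matrix is the equation of a line
    that contains the whole curve. *)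
Lemma quad_curve_line Q : coeff_mx Q \notin unitmx ->
  exists2 v : 'rV[R]_3, v != 0 & forall t, quad_curve Q t *m v^T = 0.
Proof.
rewrite -unitmx_tr unitmxE unitfE negbK => /det0P[v v0 h]; exists v => // t.
by rewrite quad_curveE -mulmxA -[_ *m v^T]trmxK trmx_mul trmxK h trmx0 mulmx0.
Qed.

End Conics.

Section Gap.
Variable R : realType.

(** The supremum of [C] below [t] and its infimum above [t] exist because [C]
    recurs, and belong to [C] because its complement is open. *)
Lemma gap_around (C : R -> Prop) (T t : R) : 0 < T ->
  (forall s, ~ C s -> \forall r \near s, ~ C r) ->
  (forall s, exists2 r, s <= r <= s + T & C r) -> ~ C t ->
  exists a b, [/\ C a, C b, a < t, t < b & forall r, a < r < b -> ~ C r].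
Proof.
move=> T0 oC dC nt.
pose A := [set s | s <= t /\ C s]; pose B := [set s | t <= s /\ C s].
have A0 : A !=set0.
  by have [s /andP[_ s1] ts] := dC (t - T); exists s; split => //; rewrite subrK in s1.
have B0 : B !=set0 by have [s /andP[s0 _] ts] := dC t; exists s.
have sA : has_sup A by split => //; exists t => s [].
have iB : has_inf B by split => //; exists t => s [].
have at_ : sup A <= t by apply: ge_sup => // s [].
have tb : t <= inf B by apply: lb_le_inf => // s [].
have Ca : C (sup A).
  have [//|na] := pselect (C (sup A)).
  have [e /= e0 he] := (nbhs_ballP _ _).1 (oC _ na).
  have [s As sa] := sup_adherent e0 sA.
  have sa' : s <= sup A by apply: sup_upper_bound.
  exfalso; apply: he As.2; rewrite /ball /= ger0_norm ?subr_ge0 //.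
  by rewrite ltrBlDr -ltrBlDl.
have Cb : C (inf B).
  have [//|nb] := pselect (C (inf B)).
  have [e /= e0 he] := (nbhs_ballP _ _).1 (oC _ nb).
  have [s Bs sb] := inf_adherent e0 iB.
  have sb' : inf B <= s by apply: ge_inf => //; exact: iB.2.
  exfalso; apply: he Bs.2; rewrite /ball /= distrC ger0_norm ?subr_ge0 //.
  by rewrite ltrBlDl.
exists (sup A), (inf B); split => //.
- by rewrite lt_neqAle at_ andbT; apply/eqP => e; apply: nt; rewrite -e.
- by rewrite lt_neqAle tb andbT; apply/eqP => e; apply: nt; rewrite e.
move=> r /andP[ar rb] Cr; have [rt|rt] := orP (le_total r t).
  by move: ar; rewrite ltNge => /negP; apply; apply: sup_upper_bound.
by move: rb; rewrite ltNge => /negP; apply; apply: ge_inf => //; exact: iB.2.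
Qed.

End Gap.

Section Cells.
Variables (R : realType) (n : nat).
Variable P : (n.*2).-tuple 'rV[R]_2.
Hypothesis hP : cppos P.
Implicit Types (i j k : nat) (p x y z u : 'rV[R]_2) (v w : 'rV[R]_3).
Implicit Types (a b s t : R).
Local Notation side := (side P).
Local Notation epoint := (epoint P).
Local Notation inner := (inner P).
Local Notation transverse := (transverse P).

Lemma on_pencil p t x : on (pencil p t) x <-> ev (plin p t) x = 0.
Proof. by rewrite pencilE; apply: on_pclass; rewrite lin_neq0 ?dir_neq0. Qed.

(** The sign of the coordinate [c] along the line tells on which side of [p] the
    crossing point is, hence whether the polygon is left or entered there. *)
Lemma open_side_exits p t i x : inner p -> open_side P i x -> on (pencil p t) x ->
  exists2 c, x = p + c *: dir t &
    (c < 0 /\ exits P (plin p t) i) \/ (0 < c /\ exits P (- plin p t) i).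
Proof.
move=> hp [s]; rewrite /= in_itv /= => /andP[s0 s1] xE /on_pencil h.
have u0 := dir_neq0 t; move: (h); rewrite /plin ev_lin => /(ray_on u0)[c hc].
exists c => //; have xE' : epoint i s = p + c *: dir t by rewrite -hc -xE.
have hc0 := hp i; rewrite (ray_side xE') in hc0.
have fE : ev (plin p t) (vtx P i.+1) - ev (plin p t) (vtx P i) = det2 (dir t) (edge P i).
  by rewrite /plin !ev_lin vtxS !det2E !mxE; ring.
have h' : (1 - s) * ev (plin p t) (vtx P i) + s * ev (plin p t) (vtx P i.+1) = 0.
  by rewrite -h -xE -/(epoint i s) epointE ev_comb.
set g := ev _ (vtx P i.+1) in fE h'; set f := ev _ (vtx P i) in fE h'.
have fs : f = - (s * det2 (dir t) (edge P i)) by rewrite -fE; lra.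
have gs : g = (1 - s) * det2 (dir t) (edge P i) by rewrite -fE; lra.
rewrite /exits !evN -/f -/g fs gs oppr_ge0 oppr_le0.
have [c0|c0|c0] := ltgtP c 0.
- left; split => //; rewrite nmulr_rgt0 // in hc0.
  by rewrite !mulr_ge0_le0 ?(ltW hc0) ?(ltW s0) //; lra.
- right; split => //; rewrite pmulr_rgt0 // in hc0.
  by rewrite opprK !mulr_ge0 ?(ltW hc0) ?(ltW s0) //; lra.
- by rewrite c0 mul0r ltxx in hc0.
Qed.

Lemma ends_on_exits p t i j : inner p -> ends_on P p i j t ->
  (exits P (plin p t) i /\ exits P (- plin p t) j) \/
  (exits P (plin p t) j /\ exits P (- plin p t) i).
Proof.
move=> hp [x [y [ox oy E]]].
have onx : on (pencil p t) x /\ bdry P x by have : [set x; y] x by [left]; rewrite -E.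
have ony : on (pencil p t) y /\ bdry P y by have : [set x; y] y by [right]; rewrite -E.
have [c xE hc] := open_side_exits hp ox onx.1.
have [d yE hd] := open_side_exits hp oy ony.1.
have xy : x <> y.
  have [x' [y' [bx' by' T lE _]]] := inner_chord hP hp (dir_neq0 t).
  have E' := join_bdry hP bx' by' T; rewrite -lE -pencilE E in E'.
  move=> xy; apply: (transverse_neq bx' T); rewrite -xy in E'.
  by have [[-> <-]|[<- ->]] := set2_eq E'.
have cd : ~ 0 < c * d.
  by move=> cd; apply: xy; rewrite xE yE (ray_bdry_eq hP hp onx.2 ony.2 xE yE cd).
case: hc hd => -[c0 ei] [[d0 ej]|[d0 ej]]; [|by left|by right|].
- by case: cd; rewrite nmulr_rgt0.
- by case: cd; rewrite mulr_gt0.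
Qed.

Lemma ends_on_lift p t i j : inner p -> ends_on P p i j t ->
  lifts (Gamma P p) (glift P p i j) t /\ wronsk (glift P p i j) t != 0.
Proof.
move=> hp /(ends_on_exits hp)[[ei ej]|[ej ei]].
  split; first exact: Gamma_exits.
  by have [? [? [? []]]] := wronsk_exits hP hp ei ej.
have [L0 LE] := Gamma_exits hP hp ej ei.
split; last by rewrite wronsk_gliftC; have [? [? [? []]]] := wronsk_exits hP hp ej ei.
rewrite /lifts gliftC oppr_eq0; split; first exact: L0.
by rewrite LE -scaleN1r pclassZ ?oppr_eq0 ?oner_eq0.
Qed.

Lemma ends_on_not_transition p t i j : ends_on P p i j t -> ~ transition P p t.
Proof.
move=> [x [y [ox oy E]]] [k hk].
have bk : bdry P (vtx P k).
  by rewrite -epoint0; apply: bdry_epoint; rewrite lexx ler01.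
have notv m z : open_side P m z -> vtx P k <> z.
  move=> [s]; rewrite /= in_itv /= => /andP[s0 s1] <- /(vtx_on_epoint hP).
  by move=> [[_ e]|[_ e]]; move: s0 s1; rewrite e ltxx.
have : [set x; y] (vtx P k) by rewrite -E.
by move=> [h|h]; [exact: notv ox h|exact: notv oy h].
Qed.

Lemma not_transition p t k : ~ transition P p t -> ev (plin p t) (vtx P k) != 0.
Proof. by move=> h; apply/eqP => e; apply: h; exists k; apply/on_pencil. Qed.

Lemma exits_ends_on p t i j : inner p -> ~ transition P p t ->
  exits P (plin p t) i -> exits P (- plin p t) j -> ends_on P p i j t.
Proof.
move=> hp nt ei ej.
have [s [r [d [e [s01 r01 d0 e0 [T E _ _ _]]]]]] := chord_of_exits hP hp (dir_neq0 t) ei ej.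
rewrite -pencilE in E.
have os k q : 0 <= q <= 1 -> on (pencil p t) (epoint k q) -> open_side P k (epoint k q).
  move=> /andP[q0 q1] h; exists q => //; rewrite /= in_itv /= !lt_neqAle q0 q1 !andbT.
  apply/andP; split; apply/eqP => qE; apply: nt.
    by exists k; rewrite -epoint0 qE.
  by exists k.+1; rewrite -epoint1 -qE.
exists (epoint i s), (epoint j r); split => //; apply: os => //.
  by have : [set epoint i s; epoint j r] (epoint i s) by [left]; rewrite -E => -[].
by have : [set epoint i s; epoint j r] (epoint j r) by [right]; rewrite -E => -[].
Qed.

Lemma near_not_transition p t : ~ transition P p t -> \forall s \near t, ~ transition P p s.
Proof.
move=> nt; have n1 := half_gt1 hP; have N0 : (0 < n.*2)%N by clear -n1; lia.
have : \forall s \near t, forall k : 'I_(n.*2), ev (plin p s) (vtx P k) != 0.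
  apply: (@filter_forall _ _ _ (nbhs t)) => k.
  apply: (@cvgr_neq0 _ _ _ (nbhs t) _ (fun s => ev (plin p s) (vtx P k))).
    exact: ev_plin_continuous.
  exact: not_transition.
apply: filterS => s hs [k /on_pencil hk].
have := hs (Ordinal (ltn_pmod k N0)).
by rewrite /= (@vtx_mod _ _ P (k %% n.*2) k) ?modn_mod // hk eqxx.
Qed.

(** Half a turn reverses the line, so each vertex changes sides. *)
Lemma transition_between p t : inner p -> exists2 s, t <= s <= t + pi & transition P p s.
Proof.
move=> hp; pose f s := ev (plin p s) (vtx P 0).
have fpi : f (t + pi) = - f t by rewrite /f plinN evN.
have : Num.min (f t) (f (t + pi)) <= 0 <= Num.max (f t) (f (t + pi)).
  rewrite fpi ge_min le_max oppr_ge0 oppr_le0.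
  by have [->|->] := orP (le_total (f t) 0); rewrite ?orbT.
move=> /IVT h; have [||s] := h.
- by rewrite lerDl pi_ge0.
- by apply: continuous_subspaceT; exact: ev_plin_continuous.
rewrite in_itv /= => st fs; exists s => //; exists 0%N; exact/on_pencil.
Qed.

Lemma same_sign p k a b s t : (forall r, a < r < b -> ~ transition P p r) ->
  a < s < b -> a < t < b -> 0 <= ev (plin p s) (vtx P k) -> 0 <= ev (plin p t) (vtx P k).
Proof.
move=> nt hs ht fs; rewrite leNgt; apply/negP => ft.
pose f r := ev (plin p r) (vtx P k).
have st : s <= t \/ t <= s by apply/orP; exact: le_total.
have [lo [hi [lohi lob hib hf]]] : exists lo hi, [/\ lo <= hi, a < lo, hi < b &
    Num.min (f lo) (f hi) <= 0 <= Num.max (f lo) (f hi)].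
  move: hs ht => /andP[h1 h2] /andP[h3 h4].
  case: st => st; [exists s, t|exists t, s]; split => //;
    by rewrite ge_min le_max fs (ltW ft) ?orbT.
have cf : {within `[lo, hi], continuous f}.
  by apply: continuous_subspaceT; exact: ev_plin_continuous.
have [r] := IVT lohi cf hf.
rewrite in_itv /= => /andP[r1 r2] fr; apply: (nt r).
  by rewrite (lt_le_trans lob r1) (le_lt_trans r2 hib).
by exists k; apply/on_pencil.
Qed.

(** The transitions on either side of [t] bound the cell: between them no vertex
    changes sides, and at them a vertex is on the line. *)
Lemma exists_cell p t : inner p -> ~ transition P p t ->
  exists i j a b, cell P p i j a b /\ a < t < b.
Proof.
move=> hp nt.
have [a [b [ta tb at_ tb' no]]] := gap_around (pi_gt0 R) (@near_not_transition p)
  (fun s => transition_between s hp) nt.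
have tab : a < t < b by rewrite at_.
have [i [j [ei ej]]] := exits_pair hP hp (dir_neq0 t).
have sgn k r : a < r < b -> (0 <= ev (plin p r) (vtx P k)) = (0 <= ev (plin p t) (vtx P k)).
  by move=> hr; apply/idP/idP; [exact: same_sign no hr tab|exact: same_sign no tab hr].
have neg k r : a < r < b -> (ev (plin p r) (vtx P k) <= 0) = (ev (plin p t) (vtx P k) <= 0).
  move=> hr; have nr := not_transition k (no _ hr); have nt' := not_transition k nt.
  by rewrite !le_eqVlt (negPf nr) (negPf nt') /= !ltNge (sgn k r hr).
exists i, j, a, b; split; last exact: tab.
split; first exact: lt_trans at_ tb'.
  move=> r hr; apply: (exits_ends_on hp (no r hr)).
    by move: ei; rewrite /exits (sgn _ r hr) (neg _ r hr).
  by move: ej; rewrite /exits !evN !oppr_ge0 !oppr_le0 (sgn _ r hr) (neg _ r hr).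
move=> a' b' aa bb h; split; apply/eqP; rewrite eq_le.
  rewrite aa leNgt; apply/negP => lt_.
  apply: (ends_on_not_transition (h a _)) ta.
  by rewrite lt_ (lt_le_trans _ bb) // (lt_trans at_).
rewrite bb andbT leNgt; apply/negP => lt_.
apply: (ends_on_not_transition (h b _)) tb.
by rewrite lt_ andbT (le_lt_trans aa) // (lt_trans at_).
Qed.

Section CellDual.
Variables (p : 'rV[R]_2) (i j : nat) (a b : R).
Hypothesis hp : inner p.
Hypothesis hc : cell P p i j a b.
Let Q := quad_wronsk (gquad P p i j).

Lemma wronsk_cell t : wronsk (glift P p i j) t = quad_curve Q t.
Proof. by rewrite glift_quad wronsk_quad. Qed.

Lemma cell_near D t : a < t < b ->
  \forall s \near within D (nbhs t), lifts (Gamma P p) (glift P p i j) s.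
Proof.
move=> /andP[at_ tb]; case: hc => _ he _.
have : \forall s \near t, a < s /\ s < b.
  by apply: filterS2 (lt_nbhsr at_) (lt_nbhsl tb) => s h1 h2; split.
apply: filterS => s [h1 h2] _; apply: (ends_on_lift hp (he s _)).1.
by rewrite h1.
Qed.

Lemma cell_wronsk_neq0 t : a < t < b -> quad_curve Q t != 0.
Proof.
move=> tab; case: hc => _ he _; rewrite -wronsk_cell.
exact: (ends_on_lift hp (he t tab)).2.
Qed.

Lemma cell_envelope t q : a < t < b ->
  envelope (Gamma P p) setT t q <-> q = pclass (quad_curve Q t).
Proof.
move=> tab; have w0 := cell_wronsk_neq0 tab; rewrite -wronsk_cell in w0 *.
split=> [h|->].
  apply: (envelope_eq (one_sidedT t) h _ (cell_near _ tab) w0).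
  by apply: smooth_derivable; exact: smooth_glift.
by apply: envelope_lift (cell_near _ tab) w0; exact: smooth_glift.
Qed.

Lemma cell_envelope_on :
  envelope_on (Gamma P p) `]a, b[ = (fun t => pclass (quad_curve Q t)) @` `]a, b[.
Proof.
apply/seteqP; split=> [q [t]|_ [t] + <-].
  by rewrite /= in_itv /= => tab /(cell_envelope _ tab) ->; exists t; rewrite //= in_itv.
rewrite /= in_itv /= => tab; exists t; first by rewrite /= in_itv.
exact/(cell_envelope _ tab).
Qed.

Lemma quad_curve_continuous (K : 'rV[R]_3 * 'rV[R]_3 * 'rV[R]_3) :
  continuous (quad_curve K).
Proof.
have cs : continuous (@sin R) := @continuous_sin R.
have cc : continuous (@cos R) := @continuous_cos R.
rewrite (_ : quad_curve K = fun t => (cos t * cos t) *: K.1.1 +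
  (cos t * sin t) *: K.1.2 + (sin t * sin t) *: K.2); last exact/funext.
by apply: contD; [apply: contD|]; apply: contZ; apply: contM.
Qed.

Lemma cell_connected : connected (envelope_on (Gamma P p) `]a, b[).
Proof.
rewrite cell_envelope_on; apply: connected_continuous_connected.
  by apply/connected_intervalP; exact: interval_is_interval.
apply: continuous_in_subspaceT => t; rewrite inE /= in_itv /= => tab.
apply: (@continuous_comp _ _ _ (quad_curve Q) (@pclass R)).
  exact: quad_curve_continuous.
by apply: pclass_continuous; exact: cell_wronsk_neq0.
Qed.

Lemma cell_nonempty : envelope_on (Gamma P p) `]a, b[ !=set0.
Proof.
case: (hc) => ab _ _; rewrite cell_envelope_on.
exists (pclass (quad_curve Q ((a + b) / 2))); exists ((a + b) / 2) => //.
by rewrite /= in_itv /=; apply/andP; split; lra.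
Qed.

Lemma cell_degenerate : coeff_mx Q \notin unitmx ->
  degenerate_conic_piece (envelope_on (Gamma P p) `]a, b[).
Proof.
move=> /quad_curve_line[v v0 hv]; split; first exact: cell_connected.
  exact: cell_nonempty.
have [h1 h2 h3] := rank1_degenerate v0; exists (v^T *m v); split => //.
rewrite cell_envelope_on => q [t]; rewrite /= in_itv /= => tab <-.
by apply: conic_pclass; [exact: cell_wronsk_neq0|exact: on_double_line].
Qed.

(** A constant envelope is not an arc; any line through its only value is a
    degenerate conic that contains it. *)
Lemma point_degenerate q : envelope_on (Gamma P p) `]a, b[ = [set q] ->
  degenerate_conic_piece (envelope_on (Gamma P p) `]a, b[).
Proof.
move=> E; split; [exact: cell_connected|exact: cell_nonempty|].
have [v v0 hv] := ex_orthogonal (hcoord q).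
have [h1 h2 h3] := rank1_degenerate v0; exists (v^T *m v); split => //.
by rewrite E => _ ->; exact: on_double_line.
Qed.

Lemma cell_conic : coeff_mx Q \in unitmx ->
  conic_arc (envelope_on (Gamma P p) `]a, b[) \/
  degenerate_conic_piece (envelope_on (Gamma P p) `]a, b[).
Proof.
move=> u; set S := envelope_on _ _; have [q Sq] := cell_nonempty.
have [[r Sr rq]|one] := pselect (exists2 r, S r & q <> r); last first.
  right; apply: (@point_degenerate q); apply/seteqP; split=> [r Sr|_ ->] //.
  by have [//|qr] := pselect (q = r); case: one; exists r.
left; split; [exact: cell_connected|by exists q, r|].
set K := invmx (coeff_mx Q).
have uK : K \in unitmx by rewrite unitmx_inv.
exists (K *m model_conic R *m K^T); split.
- by rewrite !trmx_mul trmxK model_conic_sym mulmxA.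
- by rewrite !unitmx_mul unitmx_tr uK model_conic_unit.
rewrite /S cell_envelope_on => q' [t]; rewrite /= in_itv /= => tab <-.
by apply: conic_pclass; [exact: cell_wronsk_neq0|exact: quad_curve_conic].
Qed.

Lemma cell_smooth t : coeff_mx Q \in unitmx -> a < t < b ->
  dual_smooth_at (Gamma P p) t.
Proof.
move=> u /andP[at_ tb]; exists (quad_curve Q); split; first exact: (smooth_quad _).1.
  apply: filterS2 (lt_nbhsr at_) (lt_nbhsl tb) => s h1 h2.
  have sab : a < s < b by rewrite h1.
  by split; [exact: cell_wronsk_neq0|exact/(cell_envelope _ sab)].
exact: quad_curve_regular.
Qed.

End CellDual.

Lemma cell_dual p i j a b : inner p -> cell P p i j a b ->
  conic_arc (envelope_on (Gamma P p) `]a, b[) \/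
  degenerate_conic_piece (envelope_on (Gamma P p) `]a, b[).
Proof.
move=> hp hc.
have [u|u] := boolP (coeff_mx (quad_wronsk (gquad P p i j)) \in unitmx).
  exact: cell_conic hp hc u.
by right; exact: cell_degenerate hp hc u.
Qed.

Lemma non_smooth p t : inner p -> ~ dual_smooth_at (Gamma P p) t ->
  transition P p t \/ exists i j a b, [/\ cell P p i j a b, a < t < b &
    degenerate_conic_piece (envelope_on (Gamma P p) `]a, b[)].
Proof.
move=> hp ns; have [tr|nt] := pselect (transition P p t); first by left.
right; have [i [j [a [b [hc tab]]]]] := exists_cell hp nt.
exists i, j, a, b; split; [exact: hc|exact: tab|].
have [u|u] := boolP (coeff_mx (quad_wronsk (gquad P p i j)) \in unitmx).
  by case: ns; exact: (@cell_smooth p i j a b hp hc t u tab).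
exact: cell_degenerate hp hc u.
Qed.

End Cells.

(** * The theorem *)

Theorem theorem6p3 (R : realType) (n : nat) (P : (n.*2).-tuple 'rV[R]_2)
    (hP : cppos P) :
  (* (a) *)
  ([/\ set_bij (band P) (band P) (Phi P),
       {within band P, continuous (Phi P)},
       (forall l, band P l -> Phi P (Phi P l) = l) &
       forall (A : 'M[R]_2) (b : 'rV[R]_2), A \in unitmx ->
         cppos (affpoly A b P) /\
         forall l, band P l ->
           Phi (affpoly A b P) (affline A b l) = affline A b (Phi P l)]) /\
  (* (b) *)
  ([/\ [set l | band P l /\ Phi P l = l] =
         [set join x (sigma P x) | x in bdry P],
       piecewise_smooth_closed (fixed_curve P) (n.*2)%:R &
       completed_dual (fixed_curve P) = @pt R @` CSS P]) /\
  (* (c) *)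
  ([set 2^-1 *: (x + sigma P x) | x in bdry P] = wigner P) /\
  (* (d) *)
  (forall p : 'rV[R]_2, (region P)° p ->
     piecewise_smooth_closed (Gamma P p) pi /\
     ART P p `<=` @pt R @` region P) /\
  (* (e) *)
  (forall o : 'rV[R]_2,
     (forall x, region P x -> region P (2 *: o - x)) ->
     (forall x, bdry P x -> sigma P x = 2 *: o - x) /\
     (forall p : 'rV[R]_2, (region P)° p -> ART P p = [set pt (2 *: o - p)])) /\
  (* (f) *)
  (forall p : 'rV[R]_2, (region P)° p ->
     (forall (i j : nat) (a b : R), cell P p i j a b ->
        conic_arc (envelope_on (Gamma P p) `]a, b[) \/
        degenerate_conic_piece (envelope_on (Gamma P p) `]a, b[)) /\
     (forall t : R, ~ dual_smooth_at (Gamma P p) t ->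
        transition P p t \/
        exists (i j : nat) (a b : R),
          [/\ cell P p i j a b, a < t < b &
              degenerate_conic_piece (envelope_on (Gamma P p) `]a, b[)])).
Proof.
split; [|split; [|split; [|split; [|split]]]].
- split; [exact: Phi_set_bij|exact: Phi_continuous|exact: PhiK|].
  by move=> A b Au; split; [exact: cppos_aff|exact: Phi_aff].
- split; [exact: fixed_lines|exact: fixed_piecewise|exact: dual_fixed].
- exact: midpoint_locus.
- move=> p; rewrite (interior_region hP) => hp.
  by split; [exact: Gamma_piecewise|exact: ART_sub].
- move=> o ho; split; first exact: central_sigma.
  by move=> p; rewrite (interior_region hP) => hp; exact: central_ART.
- move=> p; rewrite (interior_region hP) => hp; split.
    by move=> i j a b; exact: cell_dual.
  by move=> t; exact: non_smooth.
Qed.
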